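(* Let $w\in\mathbb{C}$ with $\operatorname{Re}(w)>0$, let $0<\alpha<1$, and let $\beta,\theta$ be real numbers with $0<\beta+\theta<1$. Then \[ \Lambda(\alpha,\beta,w,\theta)=\Lambda\!\left(1-\beta,\ \alpha,\ w^{-1},\ -\frac{i\theta}{w}\right)+g_0(\alpha,\beta,w,\theta), \] where \[ g_0(\alpha,\beta,w,\theta)=\frac{\pi}{w}B_2(\beta+\theta)-\pi w\,B_2(\alpha)+2\pi i\,B_1(\alpha)B_1(\beta+\theta). \]
   Context: For parameters $\alpha,\beta$, a complex number $w$ with $\operatorname{Re}(w)>0$, and a (possibly complex) fourth argument $\theta$ for which all the quantities $e^{2\pi i\theta}e^{-2\pi((n+\alpha)w-i\beta)}$ and $e^{-2\pi i\theta}e^{-2\pi((n+1-\alpha)w+i\beta)}$ ($n\ge 0$) have absolute value less than $1$, define \[ \Lambda(\alpha,\beta,w,\theta)=-\sum_{n=0}^{\infty}\Big[\log\!\big(1-e^{2\pi i\theta}e^{-2\pi((n+\alpha)w-i\beta)}\big)+\log\!\big(1-e^{-2\pi i\theta}e^{-2\pi((n+1-\alpha)w+i\beta)}\big)\Big], \] where $\log(1-x)$ denotes the principal branch (equivalently $-\sum_{m\ge1}x^m/m$ for $|x|<1$). $B_n$ denotes the $n$-th Bernoulli polynomial; in particular $B_1(x)=x-\tfrac12$ and $B_2(x)=x^2-x+\tfrac16$. *)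

(* Defs.v *)
From Stdlib Require Import Reals.
From Coquelicot Require Import Coquelicot.

Open Scope R_scope.

Definition Cexp (z : C) : C :=
  (exp (Re z) * cos (Im z), exp (Re z) * sin (Im z)).

(* Principal argument, with values in (-PI, PI] for z <> 0. *)
Definition Carg (z : C) : R :=
  if Rle_dec 0 (Im z) then acos (Re z / Cmod z) else - acos (Re z / Cmod z).

Definition Clog (z : C) : C := (ln (Cmod z), Carg z).

(* Coquelicot's [Series] is real-valued only; this is its complex analogue,
   meaningful when the series converges in C (see [CSeries_unique]). *)
Definition CSeries (a : nat -> C) : C :=
  (Series (fun n => Re (a n)), Series (fun n => Im (a n))).

Lemma CSeries_unique (a : nat -> C) (l : C) :
  is_series (V := C_NormedModule) a l -> CSeries a = l.
Proof.
intros H.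
assert (HR : is_series (fun n => Re (a n)) (Re l)).
{ apply filterlim_ext with (fun n => fst (sum_n a n)).
  - intros n. induction n as [|n IH].
    + now rewrite !sum_O.
    + rewrite !sum_Sn, <- IH. reflexivity.
  - apply (filterlim_comp _ _ _ (sum_n a) fst eventually (locally l) _ H).
    intros P [e He]. exists e. intros y Hy. apply He, Hy. }
assert (HI : is_series (fun n => Im (a n)) (Im l)).
{ apply filterlim_ext with (fun n => snd (sum_n a n)).
  - intros n. induction n as [|n IH].
    + now rewrite !sum_O.
    + rewrite !sum_Sn, <- IH. reflexivity.
  - apply (filterlim_comp _ _ _ (sum_n a) snd eventually (locally l) _ H).
    intros P [e He]. exists e. intros y Hy. apply He, Hy. }
unfold CSeries.
rewrite (is_series_unique _ _ HR), (is_series_unique _ _ HI).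
now destruct l.
Qed.

(* [bernoulli_upto n k] is the k-th Bernoulli number for k <= n, from
   sum_{j <= m} binom(m+1, j) b_j = 0 for m >= 1; in particular b_1 = -1/2. *)
Fixpoint bernoulli_upto (n : nat) : nat -> R :=
  match n with
  | O => fun _ => 1
  | S m => fun k =>
      if Nat.leb k m then bernoulli_upto m k
      else - sum_f_R0 (fun j => Binomial.C (n + 1) j * bernoulli_upto m j) m
             / INR (n + 1)
  end.

Definition bernoulli_number (n : nat) : R := bernoulli_upto n n.

Definition bernoulli_poly (n : nat) (x : R) : R :=
  sum_f_R0 (fun k => Binomial.C n k * bernoulli_number k * x ^ (n - k)) n.

Lemma bernoulli_poly_1 (x : R) : bernoulli_poly 1 x = x - 1 / 2.
Proof.
unfold bernoulli_poly, bernoulli_number; cbn -[INR Binomial.C pow].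
unfold Binomial.C; cbn -[INR]; simpl; field.
Qed.

Lemma bernoulli_poly_2 (x : R) : bernoulli_poly 2 x = x ^ 2 - x + 1 / 6.
Proof.
unfold bernoulli_poly, bernoulli_number; cbn -[INR Binomial.C pow].
unfold Binomial.C; cbn -[INR]; simpl; field.
Qed.

Definition Lambda_arg1 (alpha beta : R) (w theta : C) (n : nat) : C :=
  (Cexp (2 * PI * Ci * theta) *
   Cexp (- (2 * PI * ((INR n + alpha) * w - Ci * beta))))%C.

Definition Lambda_arg2 (alpha beta : R) (w theta : C) (n : nat) : C :=
  (Cexp (- (2 * PI * Ci * theta)) *
   Cexp (- (2 * PI * ((INR n + 1 - alpha) * w + Ci * beta))))%C.

Definition Lambda_term (alpha beta : R) (w theta : C) (n : nat) : C :=
  (Clog (1 - Lambda_arg1 alpha beta w theta n) +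
   Clog (1 - Lambda_arg2 alpha beta w theta n))%C.

Definition Lambda (alpha beta : R) (w theta : C) : C :=
  (- CSeries (Lambda_term alpha beta w theta))%C.

(* [Lambda] is total; this says that the defining expression makes sense. *)
Definition Lambda_defined (alpha beta : R) (w theta : C) : Prop :=
  0 < Re w /\
  (forall n : nat, Cmod (Lambda_arg1 alpha beta w theta n) < 1 /\
                   Cmod (Lambda_arg2 alpha beta w theta n) < 1) /\
  ex_series (V := C_NormedModule) (Lambda_term alpha beta w theta).

Definition g0 (alpha beta : R) (w : C) (theta : R) : C :=
  (PI / w * bernoulli_poly 2 (beta + theta)%R
   - PI * w * bernoulli_poly 2 alpha
   + 2 * PI * Ci * bernoulli_poly 1 alpha * bernoulli_poly 1 (beta + theta)%R)%C.

(* Main.v *)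
(* Write [e x] for [exp (2 pi i x)] and [gamma = beta + theta].  Expanding the
   logarithms and summing over [n] first turns the left-hand side into the
   Lambert series of [e (M gamma) E (M w) / M] over nonzero integers [M], where
   [E s = exp (- 2 pi alpha s) / (1 - exp (- 2 pi s))]; the right-hand side is
   the same series for [(1 - gamma, alpha, / w)].  As a function of [alpha],
   [2 pi E s] has Fourier coefficients [1 / (s + i K)], so both sides are double
   series over [(M, K)] with coefficients [1 / (2 pi M (M w + i K))] and
   [i w / (2 pi K (M w + i K))].  These differ by [- i / (2 pi M K)] plus terms on
   the axes, which are the Fourier coefficients of [g0].  The double series
   converge only conditionally; multiplying by [(1 - e gamma) (1 - e alpha)]
   replaces the coefficients by their mixed differences, after which
   everything converges absolutely and may be rearranged. *)

Require Import Defs.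
From Stdlib Require Import Reals Lra Lia List Classical ClassicalEpsilon ZArith Permutation.
From Coquelicot Require Import Coquelicot.
Import ListNotations.

Open Scope R_scope.


(** * Unconditional summation over an arbitrary index type *)

(** Each side needs only one of the two factors for absolute convergence. A difference in [K] brings
    the coefficients of the left-hand side down to the size [1 / (|M| (|M| + |K|) ^ 2)]; on the
    right-hand side, where the frequencies are exchanged, a difference in [M] does the same.
    Multiplying by both makes the two comparable term by term. On the side of functions, [1 - e t]
    vanishes at both ends of the unit interval and so removes the jump in the periodic extensions of
    [B_1] and [E]. What remains is continuous with summable Fourier coefficients, and such a
    function equals its series at interior points. The bounds on [alpha] and [beta + theta] place
    the two points in the interior and also keep both factors nonzero, so that they can be cancelled
    at the end. All sums are limits over the finite subsets of the index set, so reindexing and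
    exchange of summation refer to no enumeration of [Z] or of pairs of integers. *)

Definition lsum {T : Type} (a : T -> C) (L : list T) : C :=
  fold_right (fun t z => a t + z)%C (RtoC 0) L.

Definition lsumR {T : Type} (f : T -> R) (L : list T) : R :=
  fold_right (fun t z => f t + z) 0 L.

(** Convergence along the net of finite subsets, a finite set being a list without repetition. No
    order on [T] enters, so one notion serves [nat], [Z] and pairs. *)
Definition has_sum {T : Type} (a : T -> C) (l : C) : Prop :=
  forall eps, 0 < eps -> exists L0 : list T,
    forall L, NoDup L -> incl L0 L -> Cmod (lsum a L - l) < eps.

(** For the nonnegative majorants to which this is applied, bounded finite sums already mean
    summability. *)
Definition bounded_sums {T : Type} (f : T -> R) : Prop :=
  exists B, forall L, NoDup L -> lsumR f L <= B.

(** Excluded middle stands in for a decidable equality on [T]; with it, unions of finite sets can be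
    formed by concatenating lists. *)
Lemma exists_NoDup {T : Type} (L : list T) :
  exists L', NoDup L' /\ forall x, In x L' <-> In x L.
Proof.
induction L as [|x L [L' [H1 H2]]].
- exists []. split; [constructor | tauto].
- destruct (classic (In x L')) as [Hx|Hx].
  + exists L'. split; [exact H1|]. intros y. simpl. rewrite <- H2.
    split; [tauto|]. intros [<-|H]; tauto.
  + exists (x :: L'). split; [now constructor|]. intros y. simpl.
    rewrite H2. tauto.
Qed.

Lemma has_sum_unique {T : Type} (a : T -> C) (l l' : C) :
  has_sum a l -> has_sum a l' -> l = l'.
Proof.
intros H H'.
destruct (Ceq_dec l l') as [e|n]; [exact e|exfalso].
assert (Hp : 0 < Cmod (l - l')).
{ apply Cmod_gt_0. intros E. apply n.
  replace l with ((l - l') + l')%C by ring. rewrite E. ring. }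
destruct (H (Cmod (l - l') / 2)) as [L0 HL0]; [lra|].
destruct (H' (Cmod (l - l') / 2)) as [L1 HL1]; [lra|].
destruct (exists_NoDup (L0 ++ L1)) as [L [HL1' HL2]].
specialize (HL0 L HL1'). specialize (HL1 L HL1').
assert (A0 : incl L0 L) by (intros x Hx; apply HL2, in_or_app; auto).
assert (A1 : incl L1 L) by (intros x Hx; apply HL2, in_or_app; auto).
specialize (HL0 A0). specialize (HL1 A1).
pose proof (Cmod_triangle (- (lsum a L - l)) (lsum a L - l'))%C as Ht.
rewrite Cmod_opp in Ht.
replace (- (lsum a L - l) + (lsum a L - l'))%C with (l - l')%C in Ht by ring.
lra.
Qed.

Lemma lsum_ext {T : Type} (a b : T -> C) L :
  (forall t, In t L -> a t = b t) -> lsum a L = lsum b L.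
Proof.
induction L as [|x L IH]; intros H; [reflexivity|].
simpl. rewrite IH, H; [reflexivity|now left|].
intros t Ht. apply H. now right.
Qed.

Lemma lsum_plus {T : Type} (a b : T -> C) L :
  lsum (fun t => a t + b t)%C L = (lsum a L + lsum b L)%C.
Proof.
induction L as [|x L IH]; simpl; [ring|]. rewrite IH. ring.
Qed.

Lemma lsum_scal {T : Type} (c : C) (a : T -> C) L :
  lsum (fun t => c * a t)%C L = (c * lsum a L)%C.
Proof.
induction L as [|x L IH]; simpl; [ring|]. rewrite IH. ring.
Qed.

Lemma lsum_app {T : Type} (a : T -> C) L L' :
  lsum a (L ++ L') = (lsum a L + lsum a L')%C.
Proof.
induction L as [|x L IH]; simpl; [ring|]. rewrite IH. ring.
Qed.

Lemma lsum_map {T U : Type} (g : T -> U) (a : U -> C) L :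
  lsum a (map g L) = lsum (fun t => a (g t)) L.
Proof. induction L as [|x L IH]; simpl; [|rewrite IH]; reflexivity. Qed.

Lemma lsumR_app {T : Type} (f : T -> R) L L' :
  lsumR f (L ++ L') = lsumR f L + lsumR f L'.
Proof.
induction L as [|x L IH]; simpl; [ring|]. rewrite IH. ring.
Qed.

Lemma lsumR_map {T U : Type} (g : T -> U) (f : U -> R) L :
  lsumR f (map g L) = lsumR (fun t => f (g t)) L.
Proof. induction L as [|x L IH]; simpl; [|rewrite IH]; reflexivity. Qed.

Lemma lsumR_scal {T : Type} (c : R) (f : T -> R) L :
  lsumR (fun t => c * f t) L = c * lsumR f L.
Proof. induction L as [|x L IH]; simpl; [ring|]. rewrite IH. ring. Qed.

Lemma lsumR_le {T : Type} (f g : T -> R) L :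
  (forall t, f t <= g t) -> lsumR f L <= lsumR g L.
Proof.
intros H. induction L as [|x L IH]; simpl; [lra|]. specialize (H x). lra.
Qed.

Lemma lsumR_ge_0 {T : Type} (f : T -> R) L :
  (forall t, 0 <= f t) -> 0 <= lsumR f L.
Proof.
intros H. induction L as [|x L IH]; simpl; [lra|]. specialize (H x). lra.
Qed.

Lemma lsumR_incl {T : Type} (f : T -> R) L L' :
  (forall t, 0 <= f t) -> NoDup L -> incl L L' -> lsumR f L <= lsumR f L'.
Proof.
intros Hf HL. revert L'.
induction HL as [|x L Hx HL IH]; intros L' Hi.
- now apply lsumR_ge_0.
- destruct (in_split x L') as [A [B E]]; [apply Hi; now left|].
  subst L'. rewrite lsumR_app. simpl.
  assert (H : lsumR f L <= lsumR f (A ++ B)).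
  { apply IH. intros y Hy. assert (Hy' := Hi y (or_intror Hy)).
    apply in_app_or in Hy'. apply in_or_app.
    destruct Hy' as [?|[<-|?]]; tauto. }
  rewrite lsumR_app in H. lra.
Qed.

Lemma Cmod_lsum {T : Type} (a : T -> C) (f : T -> R) L :
  (forall t, Cmod (a t) <= f t) -> Cmod (lsum a L) <= lsumR f L.
Proof.
intros H. induction L as [|x L IH]; simpl.
- rewrite Cmod_0. lra.
- eapply Rle_trans; [apply Cmod_triangle|]. specialize (H x). lra.
Qed.

Lemma has_sum_ext {T : Type} (a b : T -> C) l :
  (forall t, a t = b t) -> has_sum a l -> has_sum b l.
Proof.
intros E H eps He. destruct (H eps He) as [L0 HL]. exists L0.
intros L H1 H2. rewrite <- (lsum_ext a b); auto.
Qed.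

Lemma has_sum_plus {T : Type} (a b : T -> C) l l' :
  has_sum a l -> has_sum b l' -> has_sum (fun t => a t + b t)%C (l + l')%C.
Proof.
intros H H' eps He.
destruct (H (eps / 2)) as [L0 H0]; [lra|].
destruct (H' (eps / 2)) as [L1 H1]; [lra|].
exists (L0 ++ L1). intros L HL Hi. rewrite lsum_plus.
apply incl_app_inv in Hi.
specialize (H0 L HL (proj1 Hi)). specialize (H1 L HL (proj2 Hi)).
pose proof (Cmod_triangle (lsum a L - l) (lsum b L - l'))%C.
replace (lsum a L + lsum b L - (l + l'))%C
  with ((lsum a L - l) + (lsum b L - l'))%C by ring.
lra.
Qed.

Lemma has_sum_scal {T : Type} (c : C) (a : T -> C) l :
  has_sum a l -> has_sum (fun t => c * a t)%C (c * l)%C.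
Proof.
intros H eps He.
assert (Hc := Cmod_ge_0 c).
destruct (H (eps / (Cmod c + 1))) as [L0 HL].
{ apply Rdiv_lt_0_compat; lra. }
exists L0. intros L H1 H2. specialize (HL L H1 H2).
rewrite lsum_scal.
replace (c * lsum a L - c * l)%C with (c * (lsum a L - l))%C by ring.
rewrite Cmod_mult.
apply Rlt_le_trans with ((Cmod c + 1) * (eps / (Cmod c + 1))).
- assert (H3 := Cmod_ge_0 (lsum a L - l)%C). nra.
- right. field. lra.
Qed.

Lemma has_sum_minus {T : Type} (a b : T -> C) l l' :
  has_sum a l -> has_sum b l' -> has_sum (fun t => a t - b t)%C (l - l')%C.
Proof.
intros H H'.
replace (l - l')%C with (l + (RtoC (-1)) * l')%C by ring.
apply has_sum_ext with (fun t => a t + (RtoC (-1)) * b t)%C.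
- intros t. ring.
- apply has_sum_plus; [exact H|]. now apply has_sum_scal.
Qed.

Lemma has_sum_zero {T : Type} : has_sum (fun _ : T => RtoC 0) 0.
Proof.
intros eps He. exists []. intros L _ _.
replace (lsum (fun _ : T => RtoC 0) L) with (RtoC 0).
- replace (0 - 0)%C with (RtoC 0) by ring. now rewrite Cmod_0.
- induction L as [|x L IH]; simpl; [reflexivity|]. rewrite <- IH. ring.
Qed.

(** A finite set in [U] contributes only through its preimage under [p], which by injectivity is a
    finite set with the same sum. This covers both reindexing and extension by zero. *)
Lemma has_sum_injection {T U : Type} (p : T -> U) (a : T -> C) (b : U -> C) l :
  (forall t t', p t = p t' -> t = t') ->
  (forall t, b (p t) = a t) ->
  (forall u, (forall t, p t <> u) -> b u = 0) ->
  has_sum a l -> has_sum b l.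
Proof.
intros Hinj Hab Hb H eps He.
destruct (H eps He) as [L0 HL0].
exists (map p L0). intros L HL Hi.
assert (HE : exists L', NoDup L' /\ lsum b L = lsum a L' /\
  forall t, In t L' <-> In (p t) L).
{ clear Hi. induction HL as [|u L Hu HL [L' [H1 [H2 H3]]]].
  - exists []. split; [constructor|]. split; [reflexivity|]. simpl; tauto.
  - destruct (classic (exists t, p t = u)) as [[t Ht]|Hn].
    + exists (t :: L'). split; [|split].
      * constructor; [|exact H1]. rewrite H3, Ht. exact Hu.
      * simpl. now rewrite H2, <- Ht, Hab.
      * intros s. simpl. rewrite H3, <- Ht.
        split; (intros [E|E]; [left|now right]); [now subst|].
        symmetry. apply Hinj. congruence.
    + exists L'. split; [exact H1|]. split.
      * simpl. rewrite H2, Hb; [ring|]. intros t Ht. apply Hn. now exists t.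
      * intros s. simpl. rewrite H3. split; [tauto|].
        intros [E|E]; [|exact E]. exfalso. apply Hn. now exists s. }
destruct HE as [L' [H1 [H2 H3]]]. rewrite H2. apply HL0; [exact H1|].
intros t Ht. apply H3, Hi, in_map, Ht.
Qed.

Lemma has_sum_bijection {T U : Type} (p : T -> U) (q : U -> T) (a : T -> C)
    (b : U -> C) l :
  (forall t, q (p t) = t) -> (forall u, p (q u) = u) ->
  (forall t, b (p t) = a t) -> has_sum a l -> has_sum b l.
Proof.
intros Hqp Hpq Hab. apply has_sum_injection with p.
- intros t t' E. rewrite <- (Hqp t), E. apply Hqp.
- exact Hab.
- intros u Hu. destruct (Hu (q u)). apply Hpq.
Qed.

Lemma has_sum_single {T : Type} (a : T -> C) (t0 : T) :
  (forall t, t <> t0 -> a t = 0) -> has_sum a (a t0).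
Proof.
intros H. apply has_sum_injection with (p := fun _ : unit => t0) (a := fun _ => a t0).
- now intros [] [].
- reflexivity.
- intros u Hu. apply H. intros E. now apply (Hu tt).
- intros eps He. exists [tt]. intros L HL Hi.
  assert (E : L = [tt]).
  { destruct L as [|[] L]; [destruct (Hi tt); now left|].
    destruct L as [|[] L]; [reflexivity|].
    inversion_clear HL. destruct H0. now left. }
  subst L. simpl. replace (a t0 + 0 - a t0)%C with (RtoC 0) by ring.
  now rewrite Cmod_0.
Qed.

Lemma has_sum_nonneg {T : Type} (f : T -> R) :
  (forall t, 0 <= f t) -> bounded_sums f ->
  exists l : R, has_sum (fun t => RtoC (f t)) l.
Proof.
intros Hf [B HB].
destruct (completeness (fun x => exists L, NoDup L /\ x = lsumR f L)) as [l [H1 H2]].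
- exists B. intros x [L [HL ->]]. now apply HB.
- exists 0, []. split; [constructor|reflexivity].
- exists l. intros eps He.
  destruct (classic (exists L0, NoDup L0 /\ l - eps < lsumR f L0)) as [[L0 [HN HL0]]|Hn].
  + exists L0. intros L HL Hi.
    replace (lsum (fun t => RtoC (f t)) L) with (RtoC (lsumR f L)).
    * rewrite <- RtoC_minus, Cmod_R.
      assert (lsumR f L <= l) by (apply H1; now exists L).
      assert (lsumR f L0 <= lsumR f L) by now apply lsumR_incl.
      apply Rabs_def1; lra.
    * induction L as [|x L IH] in |- *; simpl; [reflexivity|].
      now rewrite RtoC_plus, IH.
  + exfalso. assert (l <= l - eps); [|lra]. apply H2.
    intros x [L [HL ->]]. apply Rnot_lt_le. intros Hlt. apply Hn. now exists L.
Qed.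

Lemma bounded_sums_le {T : Type} (f g : T -> R) :
  (forall t, f t <= g t) -> bounded_sums g -> bounded_sums f.
Proof.
intros H [B HB]. exists B. intros L HL.
eapply Rle_trans; [apply lsumR_le, H|]. now apply HB.
Qed.

Lemma bounded_sums_scal {T : Type} (c : R) (f : T -> R) :
  0 <= c -> bounded_sums f -> bounded_sums (fun t => c * f t).
Proof.
intros H [B HB]. exists (c * B). intros L HL. rewrite lsumR_scal.
apply Rmult_le_compat_l; auto.
Qed.

(** Dominated series reduce to nonnegative ones: the real and the imaginary part [r] are each
    written as [(r + f) - f], and [r + f] lies between [0] and [2 f]. *)
Lemma has_sum_exists {T : Type} (a : T -> C) (f : T -> R) :
  (forall t, Cmod (a t) <= f t) -> bounded_sums f -> exists l, has_sum a l.
Proof.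
intros Ha Hf.
assert (Hf0 : forall t, 0 <= f t).
{ intros t. eapply Rle_trans; [apply Cmod_ge_0|apply Ha]. }
assert (H2 : bounded_sums (fun t => 2 * f t)) by (apply bounded_sums_scal; [lra|exact Hf]).
assert (real : forall r : T -> R, (forall t, Rabs (r t) <= f t) ->
  exists l, has_sum (fun t => RtoC (r t)) l).
{ intros r Hr.
  destruct (has_sum_nonneg (fun t => r t + f t)) as [l Hl].
  - intros t. specialize (Hr t). apply Rabs_le_between in Hr. lra.
  - apply bounded_sums_le with (2 := H2). intros t.
    specialize (Hr t). apply Rabs_le_between in Hr. lra.
  - destruct (has_sum_nonneg f Hf0 Hf) as [m Hm]. exists (l - m)%C.
    eapply has_sum_ext; [|exact (has_sum_minus _ _ _ _ Hl Hm)].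
    intros t. simpl. rewrite RtoC_plus. ring. }
assert (HReIm : forall z, Rabs (Re z) <= Cmod z /\ Rabs (Im z) <= Cmod z).
{ intros z. assert (Hm := Rmax_Cmod z). split; eapply Rle_trans; try exact Hm.
  - apply Rmax_l. - apply Rmax_r. }
destruct (real (fun t => Re (a t))) as [l Hl].
{ intros t. eapply Rle_trans; [apply HReIm|apply Ha]. }
destruct (real (fun t => Im (a t))) as [m Hm].
{ intros t. eapply Rle_trans; [apply HReIm|apply Ha]. }
exists (l + Ci * m)%C.
eapply has_sum_ext; [|exact (has_sum_plus _ _ _ _ Hl (has_sum_scal Ci _ _ Hm))].
intros t. simpl. destruct (a t) as [x y]. unfold Ci, RtoC, Cmult, Cplus; simpl.
f_equal; ring.
Qed.

Lemma NoDup_list_prod {T U : Type} (L : list T) (M : list U) :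
  NoDup L -> NoDup M -> NoDup (list_prod L M).
Proof.
intros HL HM. induction HL as [|x L Hx HL IH]; simpl; [constructor|].
apply NoDup_app.
- apply NoDup_map_NoDup_ForallPairs; [|exact HM]. intros u v _ _ E. congruence.
- exact IH.
- intros [t u] Hm Hp. apply in_map_iff in Hm. destruct Hm as [v [E _]].
  apply in_prod_iff in Hp. injection E as <- _. now apply Hx.
Qed.

Lemma lsum_list_prod {T U : Type} (a : T * U -> C) (L : list T) (M : list U) :
  lsum a (list_prod L M) = lsum (fun t => lsum (fun u => a (t, u)) M) L.
Proof.
induction L as [|x L IH]; simpl; [reflexivity|].
now rewrite lsum_app, lsum_map, IH.
Qed.

Lemma lsumR_list_prod {T U : Type} (f : T -> R) (g : U -> R) (L : list T) (M : list U) :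
  lsumR (fun p => f (fst p) * g (snd p)) (list_prod L M) = lsumR f L * lsumR g M.
Proof.
induction L as [|x L IH]; simpl; [ring|].
rewrite lsumR_app, lsumR_map, IH. simpl. rewrite lsumR_scal. ring.
Qed.

Lemma incl_list_prod {T U : Type} (L0 : list (T * U)) (L : list T) (M : list U) :
  incl (map fst L0) L -> incl (map snd L0) M -> incl L0 (list_prod L M).
Proof.
intros H1 H2 [t u] H. apply in_prod_iff. split.
- apply H1. exact (in_map fst _ _ H).
- apply H2. exact (in_map snd _ _ H).
Qed.

(** A finite set of pairs lies in the rectangle spanned by its two projections, and over a rectangle
    the sum factors. *)
Lemma bounded_sums_prod {T U : Type} (f : T -> R) (g : U -> R) :
  (forall t, 0 <= f t) -> (forall u, 0 <= g u) ->
  bounded_sums f -> bounded_sums g ->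
  bounded_sums (fun p : T * U => f (fst p) * g (snd p)).
Proof.
intros Hf Hg [B HB] [B' HB']. exists (B * B'). intros L HL.
destruct (exists_NoDup (map fst L)) as [L1 [N1 E1]].
destruct (exists_NoDup (map snd L)) as [L2 [N2 E2]].
apply Rle_trans with (lsumR (fun p => f (fst p) * g (snd p)) (list_prod L1 L2)).
- apply lsumR_incl; [|exact HL|].
  + intros p. now apply Rmult_le_pos.
  + apply incl_list_prod; intros x Hx; [now apply E1|now apply E2].
- rewrite lsumR_list_prod.
  apply Rmult_le_compat; auto; now apply lsumR_ge_0.
Qed.

(** For a finite [L] in [T], one finite [M] in [U] approximates all inner sums over [L] at once and
    can be enlarged until the rectangle of [L] and [M] contains [L0]. The sum over that rectangle is
    then close both to [lsum b L] and to [l]. *)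
Lemma has_sum_fubini {T U : Type} (a : T * U -> C) (b : T -> C) l :
  has_sum a l -> (forall t, has_sum (fun u => a (t, u)) (b t)) -> has_sum b l.
Proof.
intros Ha Hb eps He.
destruct (Ha (eps / 2)) as [L0 HL0]; [lra|].
exists (map fst L0). intros L HL Hi.
assert (HM : forall d, 0 < d -> exists M0, forall M, NoDup M -> incl M0 M ->
  Cmod (lsum (fun t => lsum (fun u => a (t, u)) M) L - lsum b L) <= INR (length L) * d).
{ intros d Hd. clear HL Hi. induction L as [|x L [M0 IH]].
  - exists []. intros M _ _. simpl. replace (0 - 0)%C with (RtoC 0) by ring.
    rewrite Cmod_0. lra.
  - destruct (Hb x d Hd) as [M1 H1].
    exists (M0 ++ M1). intros M HM Hi. apply incl_app_inv in Hi.
    specialize (IH M HM (proj1 Hi)). specialize (H1 M HM (proj2 Hi)).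
    cbn [length]. rewrite S_INR. cbn [lsum fold_right].
    fold (lsum (fun t => lsum (fun u => a (t, u)) M) L). fold (lsum b L).
    set (s := lsum (fun t => lsum (fun u => a (t, u)) M) L) in *.
    replace (lsum (fun u => a (x, u)) M + s - (b x + lsum b L))%C
      with ((lsum (fun u => a (x, u)) M - b x) + (s - lsum b L))%C by ring.
    eapply Rle_trans; [apply Cmod_triangle|]. lra. }
assert (Hn := pos_INR (length L)).
destruct (HM (eps / (2 * (INR (length L) + 1)))) as [M0 HM0].
{ apply Rdiv_lt_0_compat; lra. }
destruct (exists_NoDup (M0 ++ map snd L0)) as [M [HN HM']].
assert (A0 : incl M0 M) by (intros x Hx; apply HM', in_or_app; auto).
assert (A1 : incl (map snd L0) M) by (intros x Hx; apply HM', in_or_app; auto).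
specialize (HM0 M HN A0).
specialize (HL0 (list_prod L M) (NoDup_list_prod _ _ HL HN) (incl_list_prod _ _ _ Hi A1)).
rewrite lsum_list_prod in HL0.
set (s := lsum (fun t => lsum (fun u => a (t, u)) M) L) in *.
assert (Hlt : INR (length L) * (eps / (2 * (INR (length L) + 1))) < eps / 2).
{ replace (eps / (2 * (INR (length L) + 1))) with (eps / 2 / (INR (length L) + 1))
    by (field; lra).
  apply Rmult_lt_reg_r with (INR (length L) + 1); [lra|].
  replace (INR (length L) * (eps / 2 / (INR (length L) + 1)) * (INR (length L) + 1))
    with (INR (length L) * (eps / 2)) by (field; lra).
  nra. }
replace (lsum b L - l)%C with (- (s - lsum b L) + (s - l))%C by ring.
eapply Rle_lt_trans; [apply Cmod_triangle|]. rewrite Cmod_opp. lra.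
Qed.

(** The majorants give a sum of the product family, and summing over [U] first identifies its
    value. *)
Lemma has_sum_mult {T U : Type} (a : T -> C) (b : U -> C) (f : T -> R) (g : U -> R) l m :
  (forall t, Cmod (a t) <= f t) -> bounded_sums f ->
  (forall u, Cmod (b u) <= g u) -> bounded_sums g ->
  has_sum a l -> has_sum b m ->
  has_sum (fun p : T * U => a (fst p) * b (snd p))%C (l * m)%C.
Proof.
intros Ha Hf Hb Hg Hl Hm.
destruct (has_sum_exists (fun p : T * U => a (fst p) * b (snd p))%C
  (fun p => f (fst p) * g (snd p))) as [s Hs].
- intros p. rewrite Cmod_mult. apply Rmult_le_compat; auto using Cmod_ge_0.
- apply bounded_sums_prod; auto.
  + intros t. eapply Rle_trans; [apply Cmod_ge_0|apply Ha].
  + intros t. eapply Rle_trans; [apply Cmod_ge_0|apply Hb].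
- replace (l * m)%C with s; [exact Hs|].
  apply has_sum_unique with (fun t => m * a t)%C.
  + apply has_sum_fubini with (1 := Hs). intros t.
    replace (m * a t)%C with (a t * m)%C by ring.
    exact (has_sum_scal (a t) _ _ Hm).
  + replace (l * m)%C with (m * l)%C by ring. now apply has_sum_scal.
Qed.

Lemma sum_n_lsum (a : nat -> C) (n : nat) :
  sum_n (G := C_AbelianMonoid) a n = lsum a (seq 0 (S n)).
Proof.
induction n as [|n IH].
- rewrite sum_O. simpl. ring.
- rewrite sum_Sn, IH, (seq_S (S n)), lsum_app. simpl. unfold plus; simpl. ring.
Qed.

Lemma has_sum_is_series (a : nat -> C) l :
  has_sum a l -> is_series (V := C_NormedModule) a l.
Proof.
intros H P [eps HP].
destruct (H eps (cond_pos eps)) as [L0 HL0].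
exists (list_max L0). intros n Hn. apply HP.
rewrite sum_n_lsum. apply C_NormedModule_mixin_compat1.
apply HL0; [apply seq_NoDup|].
intros x Hx. apply in_seq.
assert (Hm := proj1 (list_max_le L0 (list_max L0)) (le_n _)).
rewrite Forall_forall in Hm. specialize (Hm x Hx). lia.
Qed.

Lemma bounded_sums_nat (f : nat -> R) (B : R) :
  (forall n, 0 <= f n) -> (forall n, lsumR f (seq 0 n) <= B) -> bounded_sums f.
Proof.
intros Hf HB. exists B. intros L HL.
apply Rle_trans with (2 := HB (S (list_max L))).
apply lsumR_incl; auto. intros x Hx. apply in_seq.
assert (Hm := proj1 (list_max_le L (list_max L)) (le_n _)).
rewrite Forall_forall in Hm. specialize (Hm x Hx). lia.
Qed.

Lemma bounded_sums_geom (r : R) : 0 <= r < 1 -> bounded_sums (fun n => r ^ n).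
Proof.
intros Hr. apply bounded_sums_nat with (/ (1 - r)).
- intros n. now apply pow_le.
- intros n. assert (H : lsumR (fun n => r ^ n) (seq 0 n) = (1 - r ^ n) / (1 - r)).
  { induction n as [|n IH]; [simpl; field; lra|].
    rewrite seq_S, lsumR_app, IH. simpl. field. lra. }
  rewrite H. unfold Rdiv. rewrite <- (Rmult_1_l (/ (1 - r))) at 2.
  apply Rmult_le_compat_r; [left; apply Rinv_0_lt_compat; lra|].
  assert (0 <= r ^ n) by now apply pow_le. lra.
Qed.

(** Existence comes from the majorant; splitting off the term [n = 0] then shows that the sum
    satisfies [s = 1 + z s]. *)
Lemma has_sum_geom (z : C) : Cmod z < 1 -> has_sum (fun n => z ^ n)%C (/ (1 - z))%C.
Proof.
intros Hz.
assert (Hb : bounded_sums (fun n => Cmod z ^ n)).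
{ apply bounded_sums_geom. split; [apply Cmod_ge_0|exact Hz]. }
destruct (has_sum_exists (fun n => z ^ n)%C (fun n => Cmod z ^ n)) as [s Hs].
- intros n. rewrite Cmod_pow. lra.
- exact Hb.
- assert (Hn : (1 - z)%C <> 0).
  { intros E. assert (E' : z = 1). { replace z with (1 - (1 - z))%C by ring.
    rewrite E. ring. } rewrite E', Cmod_1 in Hz. lra. }
  replace (/ (1 - z))%C with s; [exact Hs|].
  assert (E : s = (1 + z * s)%C).
  { apply has_sum_unique with (1 := Hs).
    apply has_sum_ext with (fun n => (match n with O => 1 | S _ => 0 end)
      + (match n with O => 0 | S m => z * z ^ m end))%C.
    - intros [|n]; simpl; ring.
    - apply has_sum_plus.
      + apply (has_sum_single (fun n => match n with O => RtoC 1 | S _ => RtoC 0 end) O).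
        intros [|n] Hn'; [congruence|reflexivity].
      + apply has_sum_injection with (p := S) (a := fun m => (z * z ^ m)%C).
        * intros t t' E. congruence.
        * reflexivity.
        * intros [|u] Hu; [reflexivity|]. now destruct (Hu u).
        * now apply has_sum_scal. }
  assert (E2 : ((1 - z) * s)%C = 1).
  { replace ((1 - z) * s)%C with (s - z * s)%C by ring. rewrite E at 1. ring. }
  replace s with (/ (1 - z) * ((1 - z) * s))%C by (field; exact Hn).
  rewrite E2. ring.
Qed.

(** * Sums over the integers *)

Lemma bounded_sums_Z (f : Z -> R) :
  (forall k, 0 <= f k) ->
  bounded_sums (fun n => f (Z.of_nat n)) -> bounded_sums (fun n => f (- Z.of_nat n)%Z) ->
  bounded_sums f.
Proof.
intros Hf [B HB] [B' HB']. exists (B + B'). intros L HL.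
set (N := S (list_max (map Z.abs_nat L))).
(* The integer [0] occurs in both halves, which is harmless for an upper bound with [f]
   nonnegative. *)
apply Rle_trans with (lsumR f (map Z.of_nat (seq 0 N) ++
  map (fun n => (- Z.of_nat n)%Z) (seq 0 N))).
- apply lsumR_incl; auto. intros x Hx. apply in_or_app.
  assert (Hm := proj1 (list_max_le (map Z.abs_nat L) _) (le_n _)).
  rewrite Forall_forall in Hm. specialize (Hm _ (in_map Z.abs_nat _ _ Hx)).
  destruct (Z_le_gt_dec 0 x) as [H|H]; [left|right]; apply in_map_iff;
    exists (Z.abs_nat x); (split; [lia|apply in_seq; unfold N; lia]).
- rewrite lsumR_app, !lsumR_map.
  specialize (HB _ (seq_NoDup N 0)). specialize (HB' _ (seq_NoDup N 0)). lra.
Qed.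

Lemma has_sum_Z (a : Z -> C) l m :
  a 0%Z = 0 -> has_sum (fun n => a (Z.of_nat (S n))) l ->
  has_sum (fun n => a (- Z.of_nat (S n))%Z) m -> has_sum a (l + m)%C.
Proof.
intros H0 Hl Hm.
apply has_sum_ext with (fun k => (if Z_lt_dec 0 k then a k else 0)
  + (if Z_lt_dec k 0 then a k else 0))%C.
- intros k. destruct (Z_lt_dec 0 k), (Z_lt_dec k 0); try lia; try ring.
  replace k with 0%Z by lia. rewrite H0. ring.
- apply has_sum_plus.
  + eapply has_sum_injection with (p := fun n => Z.of_nat (S n)); [| | |exact Hl].
    * intros; lia.
    * intros t. simpl. destruct (Z_lt_dec 0 (Z.of_nat (S t))); [reflexivity|lia].
    * intros k Hk. destruct (Z_lt_dec 0 k); [|reflexivity].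
      destruct (Hk (Z.to_nat (k - 1))). lia.
  + eapply has_sum_injection with (p := fun n => (- Z.of_nat (S n))%Z); [| | |exact Hm].
    * intros; lia.
    * intros t. destruct (Z_lt_dec (- Z.of_nat (S t)) 0); [reflexivity|lia].
    * intros k Hk. destruct (Z_lt_dec k 0); [|reflexivity].
      destruct (Hk (Z.to_nat (- k - 1))). lia.
Qed.

(* The exponent 3/2 comes from [(X + Y) ^ 2 >= Y sqrt (X Y)]: the coefficients
   [1 / (X (X + Y) ^ 2)] of the double series are then at most
   [X ^ (- 3 / 2) Y ^ (- 3 / 2)]. *)
Definition decay (k : Z) : R :=
  / ((1 + Rabs (IZR k)) * sqrt (1 + Rabs (IZR k))).

Lemma decay_pos k : 0 < decay k.
Proof.
assert (H := Rabs_pos (IZR k)). unfold decay.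
apply Rinv_0_lt_compat, Rmult_lt_0_compat; [lra|]. apply sqrt_lt_R0. lra.
Qed.

Lemma bounded_sums_decay : bounded_sums decay.
Proof.
assert (Hn : bounded_sums (fun n => decay (Z.of_nat n))).
{ apply bounded_sums_nat with 3; [intros n; left; apply decay_pos|].
  (* The bound telescopes, since [2 / sqrt x] is the integral of [t ^ (- 3 / 2)] from [x] to
     infinity. The constant [3] gives equality at [n = 0]. *)
  assert (Hs : forall n, lsumR (fun n => decay (Z.of_nat n)) (seq 0 (S n))
    <= 3 - 2 / sqrt (INR (S n))).
  { induction n as [|n IH].
    - simpl. unfold decay. simpl. rewrite Rabs_R0. replace (1 + 0) with 1 by ring.
      rewrite sqrt_1. lra.
    - rewrite seq_S, lsumR_app.
      set (s := lsumR _ (seq 0 (S n))) in *. cbn [lsumR fold_right].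
      rewrite Rplus_0_r. change (0 + S n)%nat with (S n).
      unfold decay. rewrite <- INR_IZR_INZ.
      assert (Hp := pos_INR n).
      rewrite Rabs_pos_eq by (apply pos_INR).
      rewrite (S_INR (S n)). rewrite (Rplus_comm 1 (INR (S n))).
      set (x := INR (S n)) in *.
      assert (Hx : 0 < x) by (unfold x; rewrite S_INR; lra).
      assert (H1 : 0 < sqrt x) by (apply sqrt_lt_R0; lra).
      assert (H2 : 0 < sqrt (x + 1)) by (apply sqrt_lt_R0; lra).
      assert (E1 : sqrt x * sqrt x = x) by (apply sqrt_sqrt; lra).
      assert (E2 : sqrt (x + 1) * sqrt (x + 1) = x + 1) by (apply sqrt_sqrt; lra).
      set (p := sqrt x) in *. set (q := sqrt (x + 1)) in *.
      assert (Hpq : p < q) by (apply sqrt_lt_1; lra).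
      assert (H3 : / ((x + 1) * q) <= 2 / p - 2 / q); [|lra].
      rewrite <- E2.
      replace (2 / p - 2 / q) with (2 * (q * q - p * p) / (p * q * (q + p)))
        by (field; lra).
      replace (q * q - p * p) with 1 by lra.
      rewrite Rmult_1_r.
      apply Rmult_le_reg_r with (q * q * q * (p * q * (q + p))).
      { repeat apply Rmult_lt_0_compat; lra. }
      replace (/ (q * q * q) * (q * q * q * (p * q * (q + p))))
        with (p * q * (q + p)) by (field; lra).
      replace (2 / (p * q * (q + p)) * (q * q * q * (p * q * (q + p))))
        with (2 * (q * q * q)) by (field; lra).
      assert (p * (q + p) <= 2 * (q * q)) by nra. nra. }
  intros [|n]; [simpl; lra|]. eapply Rle_trans; [apply Hs|].
  assert (0 < 2 / sqrt (INR (S n))); [|lra].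
  apply Rdiv_lt_0_compat; [lra|]. apply sqrt_lt_R0, lt_0_INR. lia. }
apply bounded_sums_Z; [intros; left; apply decay_pos|exact Hn|].
apply bounded_sums_le with (2 := Hn). intros n. unfold decay.
rewrite opp_IZR, Rabs_Ropp. lra.
Qed.


(** * Complex-valued functions of a real variable *)

Lemma Im_le_Cmod z : Rabs (Im z) <= Cmod z.
Proof. eapply Rle_trans; [apply Rmax_r|apply Rmax_Cmod]. Qed.

Lemma Cmod_le_Re_Im z : Cmod z <= Rabs (Re z) + Rabs (Im z).
Proof.
replace z with (RtoC (Re z) + Ci * RtoC (Im z))%C at 1.
- eapply Rle_trans; [apply Cmod_triangle|].
  rewrite Cmod_mult, Cmod_Ci, !Cmod_R. lra.
- destruct z as [x y]. unfold Ci, RtoC, Cmult, Cplus; simpl. f_equal; ring.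
Qed.

Lemma Cexp_plus y z : Cexp (y + z) = (Cexp y * Cexp z)%C.
Proof.
destruct y as [a b], z as [c d]. unfold Cexp, Cmult, Cplus; simpl.
rewrite exp_plus, cos_plus, sin_plus. f_equal; ring.
Qed.

Lemma Cexp_0 : Cexp 0 = 1.
Proof. unfold Cexp; simpl. rewrite exp_0, cos_0, sin_0. unfold RtoC. f_equal; ring. Qed.

Lemma Cmod_Cexp z : Cmod (Cexp z) = exp (Re z).
Proof.
unfold Cmod, Cexp; cbn [fst snd].
replace ((exp (Re z) * cos (Im z)) ^ 2 + (exp (Re z) * sin (Im z)) ^ 2)
  with (exp (Re z) ^ 2 * (Rsqr (sin (Im z)) + Rsqr (cos (Im z)))) by (unfold Rsqr; ring).
rewrite sin2_cos2, Rmult_1_r. apply sqrt_pow2. left. apply exp_pos.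
Qed.

Lemma Cexp_neq_0 z : Cexp z <> 0.
Proof. apply Cmod_gt_0. rewrite Cmod_Cexp. apply exp_pos. Qed.

Lemma Cexp_opp z : Cexp (- z) = (/ Cexp z)%C.
Proof.
assert (H := Cexp_plus z (- z)). replace (z + - z)%C with (RtoC 0) in H by ring.
rewrite Cexp_0 in H.
replace (Cexp (- z)) with ((Cexp z * Cexp (- z)) * / Cexp z)%C
  by (field; apply Cexp_neq_0).
rewrite <- H. ring.
Qed.

Lemma Cexp_INR_mult n z : Cexp (INR n * z) = (Cexp z ^ n)%C.
Proof.
induction n as [|n IH].
- simpl. replace (0 * z)%C with (RtoC 0) by ring. apply Cexp_0.
- rewrite S_INR, RtoC_plus, Cpow_S, <- IH, <- Cexp_plus. f_equal. ring.
Qed.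

Definition e (x : R) : C := (cos (2 * PI * x), sin (2 * PI * x)).

Lemma e_Cexp x : e x = Cexp (2 * PI * Ci * x).
Proof.
unfold e, Cexp.
replace (2 * PI * Ci * x)%C with ((0, 2 * PI * x) : C).
- cbn [Re Im fst snd]. rewrite exp_0. f_equal; ring.
- unfold Ci, RtoC, Cmult; simpl. f_equal; ring.
Qed.

Lemma e_plus x y : e (x + y) = (e x * e y)%C.
Proof. rewrite !e_Cexp, <- Cexp_plus, RtoC_plus. f_equal. ring. Qed.

Lemma e_0 : e 0 = 1.
Proof. unfold e. rewrite Rmult_0_r, cos_0, sin_0. reflexivity. Qed.

Lemma Cmod_e x : Cmod (e x) = 1.
Proof.
rewrite e_Cexp, Cmod_Cexp.
replace (Re (2 * PI * Ci * x)%C) with 0; [apply exp_0|].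
unfold Ci, RtoC, Cmult; simpl. ring.
Qed.

Lemma e_nat n : e (INR n) = 1.
Proof.
induction n as [|n IH]; [apply e_0|].
rewrite S_INR, e_plus, IH. unfold e.
rewrite Rmult_1_r, cos_2PI, sin_2PI. apply Cmult_1_l.
Qed.

Lemma e_Z k : e (IZR k) = 1.
Proof.
destruct (Z_le_gt_dec 0 k) as [H|H].
- rewrite <- (Z2Nat.id k H), <- INR_IZR_INZ. apply e_nat.
- assert (E := e_plus (IZR k) (IZR (- k))).
  rewrite <- plus_IZR, Z.add_opp_diag_r, e_0 in E.
  rewrite <- (Z2Nat.id (- k)) in E by lia.
  rewrite <- INR_IZR_INZ, e_nat in E. rewrite E. ring.
Qed.

(** The real part is [2 sin (PI x) ^ 2]. *)
Lemma e_neq_1 x : 0 < x < 1 -> (1 - e x)%C <> 0.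
Proof.
intros Hx E.
assert (HP := PI_RGT_0).
assert (Ec : 1 - cos (2 * (PI * x)) = 0).
{ rewrite <- Rmult_assoc. exact (f_equal fst E). }
rewrite cos_2a_sin in Ec.
assert (0 < sin (PI * x)); [|nra].
apply sin_gt_0; nra.
Qed.

(** Taken componentwise, so that the real mean value theorem and the real fundamental theorem of
    calculus apply to each part. *)
Definition cderiv (f : R -> C) (t : R) (l : C) : Prop :=
  is_derive (fun t => Re (f t)) t (Re l) /\ is_derive (fun t => Im (f t)) t (Im l).

Lemma cderiv_const c t : cderiv (fun _ => c) t 0.
Proof. split; apply @is_derive_const. Qed.

Lemma cderiv_id t : cderiv RtoC t 1.
Proof. split; simpl; [apply @is_derive_id|apply @is_derive_const]. Qed.

Lemma cderiv_plus f g t l m :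
  cderiv f t l -> cderiv g t m -> cderiv (fun t => f t + g t)%C t (l + m)%C.
Proof.
intros [H1 H2] [H3 H4]. split.
- apply (is_derive_plus (fun t => Re (f t)) (fun t => Re (g t)) _ _ _ H1 H3).
- apply (is_derive_plus (fun t => Im (f t)) (fun t => Im (g t)) _ _ _ H2 H4).
Qed.

Lemma cderiv_eq f t l m : cderiv f t l -> l = m -> cderiv f t m.
Proof. now intros H <-. Qed.

Lemma cderiv_mult f g t l m :
  cderiv f t l -> cderiv g t m ->
  cderiv (fun t => f t * g t)%C t (l * g t + f t * m)%C.
Proof.
intros [H1 H2] [H3 H4]. split.
- eapply is_derive_ext with (f := fun t => Re (f t) * Re (g t) - Im (f t) * Im (g t)).
  + reflexivity.
  + replace (Re (l * g t + f t * m)) with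
      ((Re l * Re (g t) + Re (f t) * Re m) - (Im l * Im (g t) + Im (f t) * Im m))
      by (simpl; unfold Re, Im; ring).
    apply (is_derive_minus (fun t => Re (f t) * Re (g t)) (fun t => Im (f t) * Im (g t)));
      apply @is_derive_mult; try assumption; intros; apply Rmult_comm.
- eapply is_derive_ext with (f := fun t => Re (f t) * Im (g t) + Im (f t) * Re (g t)).
  + reflexivity.
  + replace (Im (l * g t + f t * m)) with
      ((Re l * Im (g t) + Re (f t) * Im m) + (Im l * Re (g t) + Im (f t) * Re m))
      by (simpl; unfold Re, Im; ring).
    apply (is_derive_plus (fun t => Re (f t) * Im (g t)) (fun t => Im (f t) * Re (g t)));
      apply @is_derive_mult; try assumption; intros; apply Rmult_comm.
Qed.

Lemma cderiv_scal c f t l : cderiv f t l -> cderiv (fun t => c * f t)%C t (c * l)%C.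
Proof.
intros H. eapply cderiv_eq; [exact (cderiv_mult _ _ _ _ _ (cderiv_const c t) H)|].
cbv beta. ring.
Qed.

Lemma cderiv_Cexp z t : cderiv (fun t => Cexp (t * z)) t (z * Cexp (t * z))%C.
Proof.
destruct z as [a b].
assert (E : forall u : R, (u * (a, b))%C = (u * a, u * b)).
{ intros u. unfold Cmult, RtoC; simpl. f_equal; ring. }
split.
- apply is_derive_ext with (fun t => exp (t * a) * cos (t * b)).
  + intros u. now rewrite E.
  + auto_derive; [exact I|]. rewrite E. unfold Cexp, Cmult; simpl. ring.
- apply is_derive_ext with (fun t => exp (t * a) * sin (t * b)).
  + intros u. now rewrite E.
  + auto_derive; [exact I|]. rewrite E. unfold Cexp, Cmult; simpl. ring.
Qed.

Lemma cderiv_pow n t :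
  cderiv (fun t => RtoC t ^ S n)%C t (RtoC (INR (S n)) * RtoC t ^ n)%C.
Proof.
induction n as [|n IH].
- eapply cderiv_eq; [exact (cderiv_mult _ _ _ _ _ (cderiv_id t) (cderiv_const 1 t))|].
  simpl. ring.
- eapply cderiv_eq; [exact (cderiv_mult _ _ _ _ _ (cderiv_id t) IH)|].
  cbv beta. rewrite (S_INR (S n)), RtoC_plus, !Cpow_S. ring.
Qed.

Lemma cderiv_lsum {T : Type} (f : T -> R -> C) (df : T -> C) t L :
  (forall k, cderiv (f k) t (df k)) ->
  cderiv (fun t => lsum (fun k => f k t) L) t (lsum df L).
Proof.
intros H. induction L as [|x L IH]; simpl; [apply cderiv_const|].
now apply cderiv_plus.
Qed.

(** The mean value theorem is applied to the real and the imaginary part separately, whence the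
    factor [2]. *)
Lemma cderiv_bound f df K :
  (forall t, 0 <= t <= 1 -> cderiv f t (df t)) ->
  (forall t, 0 <= t <= 1 -> Cmod (df t) <= K) ->
  Cmod (f 1 - f 0) <= 2 * K.
Proof.
intros Hd HK.
assert (key : forall g dg : R -> R, (forall t, 0 <= t <= 1 -> is_derive g t (dg t)) ->
  (forall t, 0 <= t <= 1 -> Rabs (dg t) <= K) -> Rabs (g 1 - g 0) <= K).
{ intros g dg H1 H2.
  destruct (MVT_gen g 0 1 dg) as [c [Hc E]].
  - intros x Hx. rewrite Rmin_left, Rmax_right in Hx by lra. apply H1. lra.
  - intros x Hx. rewrite Rmin_left, Rmax_right in Hx by lra.
    apply continuity_pt_filterlim, (ex_derive_continuous g). exists (dg x). now apply H1.
  - rewrite Rmin_left, Rmax_right in Hc by lra.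
    rewrite E, Rminus_0_r, Rmult_1_r. now apply H2. }
assert (H1 := key _ _ (fun t Ht => proj1 (Hd t Ht))
  (fun t Ht => Rle_trans _ _ _ (re_le_Cmod _) (HK t Ht))).
assert (H2 := key _ _ (fun t Ht => proj2 (Hd t Ht))
  (fun t Ht => Rle_trans _ _ _ (Im_le_Cmod _) (HK t Ht))).
eapply Rle_trans; [apply Cmod_le_Re_Im|]. simpl in *. unfold Re, Im, Rminus in *. lra.
Qed.

(** * The logarithmic series *)

(** The two cases of [Carg] meet on the positive real axis, where [acos] is evaluated at [1] and is
    not differentiable. The arctangent is one smooth formula on the whole right half-plane. *)
Lemma Carg_atan z : 0 < Re z -> Carg z = atan (Im z / Re z).
Proof.
destruct z as [a b]. simpl. intros Ha. unfold Carg; simpl.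
set (m := Cmod (a, b)).
assert (Hm2 : m * m = a * a + b * b).
{ unfold m, Cmod; cbn [fst snd]. rewrite sqrt_sqrt; [ring|].
  apply Rplus_le_le_0_compat; apply pow2_ge_0. }
assert (Hm : 0 < m).
{ apply Cmod_gt_0. intros E. assert (E1 := f_equal fst E). simpl in E1. lra. }
assert (E : acos (a / m) = atan (Rabs b / a)).
{ rewrite acos_atan by now apply Rdiv_lt_0_compat.
  replace (1 - (a / m)²) with ((Rabs b / m)²).
  - rewrite sqrt_Rsqr.
    + f_equal. field. lra.
    + apply Rmult_le_pos; [apply Rabs_pos|]. left. now apply Rinv_0_lt_compat.
  - rewrite !Rsqr_div', <- Rsqr_abs. unfold Rsqr. rewrite Hm2. field. nra. }
rewrite E. destruct (Rle_dec 0 b) as [H|H].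
- now rewrite Rabs_pos_eq.
- rewrite Rabs_left by lra. rewrite <- atan_opp. f_equal. field. lra.
Qed.

Lemma cderiv_Clog x t :
  0 < 1 - t * Re x -> cderiv (fun t => Clog (1 - t * x)) t (- x / (1 - t * x))%C.
Proof.
destruct x as [p q]. simpl. intros Ht.
assert (Hl : locally t (fun s => 0 < 1 - s * p)).
{ assert (Hc : continuous (fun s => 1 - s * p) t).
  { apply (ex_derive_continuous (fun s => 1 - s * p)). auto_derive. exact I. }
  apply Hc. apply (open_gt 0 (1 - t * p) Ht). }
assert (Hn : (1 - t * (p, q))%C <> 0).
{ intros E. assert (E' := f_equal fst E). simpl in E'. lra. }
assert (Hu : 0 < (1 - t * p) * (1 - t * p) + t * q * (t * q)) by nra.
assert (Ev : (- (p, q) / (1 - t * (p, q)))%C =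
  (- (p * (1 - t * p) - q * (t * q)) / ((1 - t * p) * (1 - t * p) + t * q * (t * q)),
   - q / ((1 - t * p) * (1 - t * p) + t * q * (t * q)))).
{ unfold Cdiv, Cinv, Cmult, Cminus, Cplus, Copp, RtoC; simpl.
  f_equal; field; nra. }
rewrite Ev. split.
- apply is_derive_ext_loc with
    (fun s => ln (sqrt ((1 - s * p) * (1 - s * p) + s * q * (s * q)))).
  + apply filter_forall. intros s. unfold Clog, Cmod, RtoC; simpl. f_equal. f_equal. ring.
  + set (u := (1 - t * p) * (1 - t * p) + t * q * (t * q)) in *.
    assert (Hs : 0 < sqrt u) by now apply sqrt_lt_R0.
    assert (Hs2 : sqrt u * sqrt u = u) by (apply sqrt_sqrt; lra).
    auto_derive.
    * fold u in Hs |- *. split; [exact Hu|]. split; [exact Hs|exact I].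
    * simpl. change ((1 + - (t * p)) * (1 + - (t * p)) + t * q * (t * q)) with u.
      set (r := sqrt u) in *. clearbody r. rewrite <- Hs2. field. lra.
- apply is_derive_ext_loc with (fun s => atan (- (s * q) / (1 - s * p))).
  + apply filter_imp with (2 := Hl). intros s Hs. unfold Clog.
    cbn [Im snd]. rewrite Carg_atan.
    * simpl. f_equal. f_equal; ring.
    * simpl. lra.
  + auto_derive; [lra|]. simpl. field. split; [|lra]. nra.
Qed.

Lemma Re_lt_1 x t : Cmod x < 1 -> 0 <= t <= 1 -> 0 < 1 - t * Re x.
Proof.
intros Hx Ht. assert (H := re_le_Cmod x). apply Rabs_le_between in H. nra.
Qed.

Lemma Clog_1 : Clog 1 = 0.
Proof.
unfold Clog. rewrite Cmod_1, ln_1, Carg_atan by (simpl; lra).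
simpl. unfold Rdiv. rewrite Rmult_0_l, atan_0. reflexivity.
Qed.

(* Along the segment from [0] to [x], the derivative of the left-hand side is
   [- x (t x) ^ N / (1 - t x)]. *)
Lemma mercator_remainder x N : Cmod x < 1 ->
  Cmod (lsum (fun m => x ^ S m / INR (S m)) (seq 0 N) + Clog (1 - x))%C
    <= 2 * (Cmod x ^ N / (1 - Cmod x)).
Proof.
intros Hx.
set (f := fun t : R => (lsum (fun m => x ^ S m / INR (S m) * RtoC t ^ S m) (seq 0 N)
  + Clog (1 - t * x))%C).
assert (Hn : forall t, 0 <= t <= 1 -> 1 - Cmod x <= Cmod (1 - t * x)).
{ intros t Ht. assert (H := Cmod_triangle (1 - t * x) (t * x)).
  replace (1 - t * x + t * x)%C with (RtoC 1) in H by ring.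
  rewrite Cmod_1, Cmod_mult, Cmod_R, Rabs_pos_eq in H by lra.
  assert (H' := Cmod_ge_0 x). nra. }
assert (E0 : f 0 = 0).
{ unfold f. replace (1 - 0 * x)%C with (RtoC 1) by ring. rewrite Clog_1.
  replace (lsum _ _) with (0 * lsum (fun _ : nat => RtoC 0) (seq 0 N))%C; [ring|].
  rewrite <- lsum_scal. apply lsum_ext. intros m _. rewrite !Cpow_S. ring. }
assert (E1 : f 1 = (lsum (fun m => x ^ S m / INR (S m)) (seq 0 N) + Clog (1 - x))%C).
{ unfold f. replace (1 - 1 * x)%C with (1 - x)%C by ring. f_equal.
  apply lsum_ext. intros m _. rewrite Cpow_1_l. ring. }
rewrite <- E1. replace (f 1) with (f 1 - f 0)%C by (rewrite E0; ring).
apply cderiv_bound with (fun t => - x * (t * x) ^ N / (1 - t * x))%C.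
- intros t Ht. unfold f. eapply cderiv_eq.
  + apply cderiv_plus; [|apply cderiv_Clog; now apply Re_lt_1].
    apply cderiv_lsum with (df := fun m => (x ^ S m * RtoC t ^ m)%C).
    intros m. eapply cderiv_eq; [apply cderiv_scal, cderiv_pow|].
    assert (RtoC (INR (S m)) <> 0).
    { intros H. apply RtoC_inj in H. revert H. now apply not_0_INR. }
    field. assumption.
  + assert (Hnz : (1 - t * x)%C <> 0).
    { apply Cmod_gt_0. specialize (Hn t Ht). lra. }
    assert (EN : lsum (fun m => x ^ S m * RtoC t ^ m)%C (seq 0 N)
      = (x * (1 - (t * x) ^ N) / (1 - t * x))%C).
    { clear E0 E1 f. induction N as [|N IH]; [simpl; field; exact Hnz|].
      rewrite seq_S, lsum_app, IH. cbn [lsum fold_right].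
      rewrite !Cpow_S, !Cpow_mult_l. simpl. field. exact Hnz. }
    rewrite EN. field. exact Hnz.
- intros t Ht. specialize (Hn t Ht).
  rewrite Cmod_div by (apply Cmod_gt_0; lra).
  rewrite Cmod_mult, Cmod_opp, Cmod_pow, Cmod_mult, Cmod_R, Rabs_pos_eq by lra.
  assert (H0 := Cmod_ge_0 x).
  apply Rmult_le_compat.
  + apply Rmult_le_pos; [lra|]. apply pow_le. nra.
  + left. apply Rinv_0_lt_compat. lra.
  + rewrite <- (Rmult_1_l (Cmod x ^ N)). apply Rmult_le_compat; try lra.
    * apply pow_le. nra.
    * apply pow_incr. nra.
  + apply Rinv_le_contravar; lra.
Qed.

(** The geometric majorant gives some unconditional sum [s]; only its value has to be found, and for
    that the initial segments bounded in [mercator_remainder] suffice. *)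
Lemma has_sum_Clog x : Cmod x < 1 ->
  has_sum (fun m => x ^ S m / INR (S m))%C (- Clog (1 - x))%C.
Proof.
intros Hx.
assert (Hb : bounded_sums (fun n => Cmod x ^ n)).
{ apply bounded_sums_geom. split; [apply Cmod_ge_0|exact Hx]. }
destruct (has_sum_exists (fun m => x ^ S m / INR (S m))%C (fun n => Cmod x ^ n)) as [s Hs].
{ intros m.
  assert (Hp : 1 <= INR (S m)) by (rewrite S_INR; assert (H := pos_INR m); lra).
  rewrite Cmod_div by (apply Cmod_gt_0; rewrite Cmod_R, Rabs_pos_eq; lra).
  rewrite Cmod_R, Rabs_pos_eq, Cmod_pow by lra. simpl.
  assert (Hm : 0 <= Cmod x ^ m) by (apply pow_le, Cmod_ge_0).
  assert (H0 := Cmod_ge_0 x).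
  apply Rle_trans with (1 * Cmod x ^ m / 1); [|lra].
  apply Rmult_le_compat; [apply Rmult_le_pos; assumption| |nra|].
  - left. apply Rinv_0_lt_compat. simpl in Hp. lra.
  - apply Rinv_le_contravar; [lra|exact Hp]. }
{ exact Hb. }
replace (- Clog (1 - x))%C with s; [exact Hs|].
assert (Hd : Cmod (s + Clog (1 - x)) = 0).
{ apply Rle_antisym; [|apply Cmod_ge_0]. apply le_epsilon. intros eps He.
  destruct (Hs (eps / 2)) as [L0 HL0]; [lra|].
  assert (H1 : 0 < eps / 4 * (1 - Cmod x)) by (apply Rmult_lt_0_compat; lra).
  destruct (pow_lt_1_zero (Cmod x)) with (y := eps / 4 * (1 - Cmod x)) as [N HN].
  { rewrite Rabs_pos_eq; [exact Hx|apply Cmod_ge_0]. }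
  { exact H1. }
  (* A single initial segment that contains [L0], hence is close to [s], and is long enough for a
     small Mercator remainder. *)
  set (n := (N + S (list_max L0))%nat).
  assert (Hi : incl L0 (seq 0 n)).
  { intros y Hy. apply in_seq.
    assert (Hm := proj1 (list_max_le L0 (list_max L0)) (le_n _)).
    rewrite Forall_forall in Hm. specialize (Hm y Hy). unfold n. lia. }
  specialize (HL0 _ (seq_NoDup n 0) Hi).
  specialize (HN n ltac:(unfold n; lia)).
  assert (Hr := mercator_remainder x n Hx).
  set (g := lsum _ (seq 0 n)) in *.
  rewrite Rabs_pos_eq in HN by (apply pow_le, Cmod_ge_0).
  assert (H2 : Cmod x ^ n / (1 - Cmod x) <= eps / 4).
  { apply Rmult_le_reg_r with (1 - Cmod x); [lra|].
    unfold Rdiv at 1. rewrite Rmult_assoc, Rinv_l by lra. lra. }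
  replace (s + Clog (1 - x))%C with (- (g - s) + (g + Clog (1 - x)))%C by ring.
  eapply Rle_trans; [apply Cmod_triangle|]. rewrite Cmod_opp. lra. }
apply Cmod_eq_0 in Hd.
replace s with (s + Clog (1 - x) - Clog (1 - x))%C by ring. rewrite Hd. ring.
Qed.


(** * Fourier inversion at interior points *)

Definition ccont (f : R -> C) : Prop :=
  forall t, continuous (fun t => Re (f t)) t /\ continuous (fun t => Im (f t)) t.

Lemma ccont_cderiv (f df : R -> C) : (forall t, cderiv f t (df t)) -> ccont f.
Proof.
intros H t. destruct (H t) as [H1 H2]. split.
- apply (ex_derive_continuous (fun t => Re (f t))). eexists; exact H1.
- apply (ex_derive_continuous (fun t => Im (f t))). eexists; exact H2.
Qed.

Lemma ccont_const c : ccont (fun _ => c).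
Proof. intros t; split; apply continuous_const. Qed.

Lemma ccont_plus f g : ccont f -> ccont g -> ccont (fun t => f t + g t)%C.
Proof.
intros H1 H2 t. destruct (H1 t), (H2 t). split.
- now apply (continuous_plus (fun t => Re (f t)) (fun t => Re (g t))).
- now apply (continuous_plus (fun t => Im (f t)) (fun t => Im (g t))).
Qed.

Lemma ccont_mult f g : ccont f -> ccont g -> ccont (fun t => f t * g t)%C.
Proof.
intros H1 H2 t. destruct (H1 t), (H2 t). split.
- apply (continuous_minus (fun t => Re (f t) * Re (g t)) (fun t => Im (f t) * Im (g t)));
    now apply (continuous_mult (K := R_AbsRing)).
- apply (continuous_plus (fun t => Re (f t) * Im (g t)) (fun t => Im (f t) * Re (g t)));
    now apply (continuous_mult (K := R_AbsRing)).
Qed.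

Lemma ccont_minus f g : ccont f -> ccont g -> ccont (fun t => f t - g t)%C.
Proof.
intros H1 H2 t. destruct (H1 t), (H2 t). split.
- now apply (continuous_minus (fun t => Re (f t)) (fun t => Re (g t))).
- now apply (continuous_minus (fun t => Im (f t)) (fun t => Im (g t))).
Qed.

Lemma ccont_lsum {T : Type} (f : T -> R -> C) L :
  (forall k, ccont (f k)) -> ccont (fun t => lsum (fun k => f k t) L).
Proof.
intros H. induction L as [|x L IH]; simpl; [apply ccont_const|].
now apply ccont_plus.
Qed.

Lemma e_Cexp_lin k t : e (k * t) = Cexp (t * (2 * PI * Ci * k)).
Proof. rewrite e_Cexp, RtoC_mult. f_equal. ring. Qed.

Lemma cderiv_ext f g t l : (forall t, f t = g t) -> cderiv f t l -> cderiv g t l.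
Proof.
intros E [H1 H2]. split.
- apply is_derive_ext with (2 := H1). intros u. now rewrite E.
- apply is_derive_ext with (2 := H2). intros u. now rewrite E.
Qed.

Lemma cderiv_e k t :
  cderiv (fun t => e (k * t)) t (2 * PI * Ci * k * e (k * t))%C.
Proof.
apply cderiv_ext with (fun t => Cexp (t * (2 * PI * Ci * k))).
- intros u. symmetry. apply e_Cexp_lin.
- rewrite e_Cexp_lin. apply cderiv_Cexp.
Qed.

Lemma ccont_e k : ccont (fun t => e (k * t)).
Proof. eapply ccont_cderiv. intros t. apply cderiv_e. Qed.

(** * Integrals over the unit interval *)

Definition cint (f : R -> C) (v : C) : Prop :=
  is_RInt (fun t => Re (f t)) 0 1 (Re v) /\ is_RInt (fun t => Im (f t)) 0 1 (Im v).

Lemma cint_eq f v w : cint f v -> v = w -> cint f w.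
Proof. now intros H <-. Qed.

Lemma cint_ext f g v : (forall t, f t = g t) -> cint f v -> cint g v.
Proof.
intros E [H1 H2]. split.
- apply is_RInt_ext with (2 := H1). intros t _. now rewrite E.
- apply is_RInt_ext with (2 := H2). intros t _. now rewrite E.
Qed.

Lemma cint_exists f : ccont f -> exists v, cint f v.
Proof.
intros H.
destruct (ex_RInt_continuous (V := R_CompleteNormedModule) (fun t => Re (f t)) 0 1)
  as [a Ha]; [intros; apply H|].
destruct (ex_RInt_continuous (V := R_CompleteNormedModule) (fun t => Im (f t)) 0 1)
  as [b Hb]; [intros; apply H|].
exists (a, b). now split.
Qed.

Lemma cint_plus f g v w : cint f v -> cint g w -> cint (fun t => f t + g t)%C (v + w)%C.
Proof.
intros [H1 H2] [H3 H4]. split.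
- exact (is_RInt_plus _ _ _ _ _ _ H1 H3).
- exact (is_RInt_plus _ _ _ _ _ _ H2 H4).
Qed.

Lemma cint_scal c f v : cint f v -> cint (fun t => c * f t)%C (c * v)%C.
Proof.
intros [H1 H2]. split.
- exact (is_RInt_minus _ _ _ _ _ _ (is_RInt_scal _ _ _ (Re c) _ H1)
    (is_RInt_scal _ _ _ (Im c) _ H2)).
- exact (is_RInt_plus _ _ _ _ _ _ (is_RInt_scal _ _ _ (Re c) _ H2)
    (is_RInt_scal _ _ _ (Im c) _ H1)).
Qed.

Lemma cint_minus f g v w : cint f v -> cint g w -> cint (fun t => f t - g t)%C (v - w)%C.
Proof.
intros [H1 H2] [H3 H4]. split.
- exact (is_RInt_minus _ _ _ _ _ _ H1 H3).
- exact (is_RInt_minus _ _ _ _ _ _ H2 H4).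
Qed.

Lemma is_RInt_const_R (a b c : R) : is_RInt (fun _ => c) a b (c * (b - a)).
Proof.
rewrite Rmult_comm. exact (is_RInt_const (V := R_NormedModule) a b c).
Qed.

Lemma cint_bound f v K :
  (forall t, Cmod (f t) <= K) -> cint f v -> Cmod v <= 2 * K.
Proof.
intros HK [H1 H2].
assert (Hc : is_RInt (fun _ => K) 0 1 K).
{ assert (H := is_RInt_const_R 0 1 K). now replace (K * (1 - 0)) with K in H by ring. }
assert (A1 : Rabs (Re v) <= K).
{ apply (norm_RInt_le (V := R_NormedModule) (fun t => Re (f t)) (fun _ => K) 0 1);
    [lra| |exact H1|exact Hc].
  intros t _. eapply Rle_trans; [apply re_le_Cmod|apply HK]. }
assert (A2 : Rabs (Im v) <= K).
{ apply (norm_RInt_le (V := R_NormedModule) (fun t => Im (f t)) (fun _ => K) 0 1);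
    [lra| |exact H2|exact Hc].
  intros t _. eapply Rle_trans; [apply Im_le_Cmod|apply HK]. }
eapply Rle_trans; [apply Cmod_le_Re_Im|]. lra.
Qed.

Lemma cint_cderiv F f :
  (forall t, cderiv F t (f t)) -> ccont f -> cint f (F 1 - F 0)%C.
Proof.
intros H Hc. split.
- apply (is_RInt_derive (fun t => Re (F t)) (fun t => Re (f t))).
  + intros t _. apply H.
  + intros t _. apply Hc.
- apply (is_RInt_derive (fun t => Im (F t)) (fun t => Im (f t))).
  + intros t _. apply H.
  + intros t _. apply Hc.
Qed.

Lemma cint_const c : cint (fun _ => c) c.
Proof.
eapply cint_eq; [apply cint_cderiv with (F := fun t => (c * t)%C)|].
- intros t. eapply cderiv_eq; [apply cderiv_scal, cderiv_id|]. ring.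
- apply ccont_const.
- ring.
Qed.

Lemma cint_lsum {T : Type} (f : T -> R -> C) (v : T -> C) L :
  (forall k, cint (f k) (v k)) -> cint (fun t => lsum (fun k => f k t) L) (lsum v L).
Proof.
intros H. induction L as [|x L IH]; simpl; [apply cint_const|]. now apply cint_plus.
Qed.

(** * A function with vanishing Fourier coefficients is zero *)

(** A trigonometric polynomial with frequencies [-1], [0], [1], values in the unit interval and, up
    to periods, its only maximum at [t = x]. *)
Definition bump (x t : R) : R := (1 + cos (2 * PI * (t - x))) / 2.

Lemma bump_e x t : RtoC (bump x t) =
  (1 / 2 + / 4 * e (- x) * e (1 * t) + / 4 * e x * e ((-1) * t))%C.
Proof.
unfold bump, e.
replace (2 * PI * (t - x)) with (2 * PI * t - 2 * PI * x) by ring.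
rewrite cos_minus.
replace (2 * PI * - x) with (- (2 * PI * x)) by ring.
replace (2 * PI * (1 * t)) with (2 * PI * t) by ring.
replace (2 * PI * (-1 * t)) with (- (2 * PI * t)) by ring.
rewrite !cos_neg, !sin_neg.
unfold Cdiv, Cinv, Cmult, Cplus, RtoC; simpl. f_equal; field.
Qed.

Lemma bump_range x t : 0 <= bump x t <= 1.
Proof. unfold bump. destruct (COS_bound (2 * PI * (t - x))). lra. Qed.

(** Each factor [bump] shifts the frequency by [-1], [0] or [1], so the induction on [n] must carry
    all frequencies [k] at once. *)
Lemma cint_bump g x :
  (forall k : Z, cint (fun t => g t * e (IZR k * t))%C 0) ->
  forall (n : nat) (k : Z), cint (fun t => g t * e (IZR k * t) * RtoC (bump x t) ^ n)%C 0.
Proof.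
intros H. induction n as [|n IH]; intros k.
- apply cint_ext with (2 := H k). intros t. simpl. ring.
- apply cint_ext with (fun t =>
    / 2 * (g t * e (IZR k * t) * RtoC (bump x t) ^ n)
    + (/ 4 * e (- x) * (g t * e (IZR (k + 1) * t) * RtoC (bump x t) ^ n)
    + / 4 * e x * (g t * e (IZR (k + -1) * t) * RtoC (bump x t) ^ n)))%C.
  + intros t. rewrite Cpow_S. rewrite (bump_e x t) at 4.
    rewrite !plus_IZR, !Rmult_plus_distr_r, !e_plus. field.
  + eapply cint_eq.
    * apply cint_plus; [apply cint_scal, IH|].
      apply cint_plus; apply cint_scal, IH.
    * ring.
Qed.

(** The hypothesis keeps [u] at distance at least [d] from [-1], [0] and [1]. Evenness and the
    reflection of [|u|] to [1 - |u|] bring it into the half period where the cosine decreases. *)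
Lemma cos_le_of_dist u d : 0 <= d -> d <= Rabs u <= 1 - d ->
  cos (2 * PI * u) <= cos (2 * PI * d).
Proof.
intros Hd Hu. assert (HP := PI_RGT_0).
replace (cos (2 * PI * u)) with (cos (2 * PI * Rabs u)).
2:{ unfold Rabs. destruct (Rcase_abs u); [|reflexivity].
    replace (2 * PI * - u) with (- (2 * PI * u)) by ring. apply cos_neg. }
destruct (Rle_dec (Rabs u) (1 / 2)) as [H|H].
- apply cos_decr_1; nra.
- replace (cos (2 * PI * Rabs u)) with (cos (2 * PI * (1 - Rabs u))).
  + apply cos_decr_1; nra.
  + replace (2 * PI * (1 - Rabs u)) with (- (2 * PI * Rabs u) + 2 * PI) by ring.
    now rewrite cos_plus, cos_2PI, sin_2PI, cos_neg, Rmult_1_r, Rmult_0_r, Rminus_0_r.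
Qed.

(* The powers of the bump concentrate at [x], where [h] would be positive. *)
Lemma bump_nonpos (h : R -> R) x : 0 < x < 1 ->
  (forall t, continuous h t) ->
  (forall n : nat, is_RInt (fun t => h t * bump x t ^ n) 0 1 0) -> h x <= 0.
Proof.
intros Hx Hc Hi. apply Rnot_lt_le. intros Hpos.
assert (HP := PI_RGT_0).
destruct (Hc x (fun y => h x / 2 < y)) as [d0 Hd0].
{ apply (open_gt (h x / 2)). lra. }
(* The bounds by [x] and [1 - x] do two things: the window around [x] stays inside the unit
   interval, and no [t] in that interval comes within [d] of a periodic copy of the peak. *)
set (d := Rmin (d0 / 2) (Rmin x (1 - x))).
assert (Hd : 0 < d /\ d < d0 /\ d <= x /\ d <= 1 - x).
{ assert (H := cond_pos d0). unfold d.
  assert (H1 := Rmin_l (d0 / 2) (Rmin x (1 - x))).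
  assert (H2 := Rmin_r (d0 / 2) (Rmin x (1 - x))).
  assert (H3 := Rmin_l x (1 - x)). assert (H4 := Rmin_r x (1 - x)).
  split; [|lra]. repeat apply Rmin_glb_lt; lra. }
clearbody d. destruct Hd as [Hd1 [Hd2 [Hd3 Hd4]]].
assert (Hnear : forall t, Rabs (t - x) < d -> h x / 2 < h t).
{ intros t Ht. apply Hd0. unfold ball; simpl. unfold AbsRing_ball, abs, minus, plus, opp; simpl.
  unfold Rminus in Ht. lra. }
destruct (continuity_ab_maj (fun t => Rabs (h t)) 0 1) as [m [Hm _]]; [lra| |].
{ intros t _. apply continuity_pt_filterlim.
  apply (continuous_comp h Rabs); [apply Hc|apply continuous_Rabs]. }
set (M := Rabs (h m)) in *.
assert (HM0 : 0 <= M) by apply Rabs_pos.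
(* [a] bounds the bump from above outside the window of radius [d], and [b] bounds it from below
   inside the window of radius [d / 2]. Since [a < b], the inner contribution wins for large
   powers. *)
set (a := (1 + cos (2 * PI * d)) / 2).
set (b := (1 + cos (2 * PI * (d / 2))) / 2).
assert (Ha0 : 0 <= a) by (unfold a; destruct (COS_bound (2 * PI * d)); lra).
assert (Hab : a < b).
{ unfold a, b. assert (cos (2 * PI * d) < cos (2 * PI * (d / 2))); [|lra].
  apply cos_decreasing_1; nra. }
assert (Hlow : forall n t, 0 <= t <= 1 -> - (M * a ^ n) <= h t * bump x t ^ n).
{ intros n t Ht.
  assert (Hb := bump_range x t).
  assert (Hbn : 0 <= bump x t ^ n) by now apply pow_le.
  assert (Han : 0 <= a ^ n) by now apply pow_le.
  destruct (Rlt_dec (Rabs (t - x)) d) as [H|H].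
  - specialize (Hnear t H).
    apply Rle_trans with 0; [nra|]. apply Rmult_le_pos; lra.
  - assert (Hba : bump x t ^ n <= a ^ n).
    { apply pow_incr. split; [lra|]. unfold bump, a.
      assert (cos (2 * PI * (t - x)) <= cos (2 * PI * d)); [|lra].
      apply cos_le_of_dist; [lra|]. split; [lra|].
      unfold Rabs. destruct (Rcase_abs (t - x)); lra. }
    specialize (Hm t Ht). fold M in Hm. simpl in Hm.
    apply Rabs_le_between in Hm. nra. }
assert (Hmid : forall n t, Rabs (t - x) <= d / 2 -> h x / 2 * b ^ n <= h t * bump x t ^ n).
{ intros n t Ht.
  assert (Hbb : b ^ n <= bump x t ^ n).
  { apply pow_incr. split; [lra|]. unfold bump, b.
    assert (cos (2 * PI * (d / 2)) <= cos (2 * PI * (t - x))); [|lra].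
    replace (cos (2 * PI * (t - x))) with (cos (2 * PI * Rabs (t - x))).
    2:{ unfold Rabs. destruct (Rcase_abs (t - x)); [|reflexivity].
        replace (2 * PI * - (t - x)) with (- (2 * PI * (t - x))) by ring. apply cos_neg. }
    assert (H0 := Rabs_pos (t - x)).
    apply cos_decr_1; nra. }
  assert (Hbn : 0 <= b ^ n) by (apply pow_le; lra).
  specialize (Hnear t ltac:(lra)).
  apply Rmult_le_compat; lra. }
(* The vanishing integral is cut at [x - d / 2] and [x + d / 2]: the middle piece has length [d],
   and the outer pieces have total length at most [1]. *)
assert (Hk : forall n, h x / 2 * b ^ n * d <= M * a ^ n).
{ intros n. set (k := fun t => h t * bump x t ^ n).
  assert (Hck : forall t, continuous k t).
  { intros t. apply (continuous_mult h (fun t => bump x t ^ n)); [apply Hc|].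
    apply (ex_derive_continuous (fun t => bump x t ^ n)). unfold bump. auto_derive. exact I. }
  assert (Hex : forall u v, ex_RInt k u v).
  { intros u v. apply (ex_RInt_continuous (V := R_CompleteNormedModule)). intros; apply Hck. }
  assert (Hseg : forall u v c, u <= v -> (forall t, u < t < v -> c <= k t) ->
    c * (v - u) <= RInt k u v).
  { intros u v c Huv Hkc. apply is_RInt_le with (fun _ => c) k u v; auto.
    - apply is_RInt_const_R.
    - apply (RInt_correct (V := R_CompleteNormedModule)), Hex. }
  assert (E := is_RInt_unique (V := R_CompleteNormedModule) _ _ _ _ (Hi n)). fold k in E.
  assert (C1 := RInt_Chasles (V := R_CompleteNormedModule) k 0 (x - d / 2) 1 (Hex _ _) (Hex _ _)).
  assert (C2 := RInt_Chasles (V := R_CompleteNormedModule) k (x - d / 2) (x + d / 2) 1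
    (Hex _ _) (Hex _ _)).
  unfold plus in C1, C2; simpl in C1, C2.
  assert (S1 := Hseg 0 (x - d / 2) (- (M * a ^ n)) ltac:(lra)
    (fun t Ht => Hlow n t ltac:(lra))).
  assert (S2 := Hseg (x - d / 2) (x + d / 2) (h x / 2 * b ^ n) ltac:(lra)
    (fun t Ht => Hmid n t ltac:(apply Rabs_le; lra))).
  assert (S3 := Hseg (x + d / 2) 1 (- (M * a ^ n)) ltac:(lra)
    (fun t Ht => Hlow n t ltac:(lra))).
  assert (0 <= M * a ^ n) by (apply Rmult_le_pos; [exact HM0|now apply pow_le]).
  nra. }
destruct (pow_lt_1_zero (a / b)) with (y := h x / 2 * d / (M + 1)) as [N HN].
{ rewrite Rabs_pos_eq.
  - apply Rmult_lt_reg_r with b; [lra|]. unfold Rdiv. rewrite Rmult_assoc, Rinv_l; lra.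
  - apply Rmult_le_pos; [exact Ha0|]. left. apply Rinv_0_lt_compat. lra. }
{ apply Rdiv_lt_0_compat; [|lra]. apply Rmult_lt_0_compat; lra. }
specialize (HN N (le_n _)). specialize (Hk N).
assert (HbN : 0 < b ^ N) by (apply pow_lt; lra).
assert (HaN : 0 <= a ^ N) by now apply pow_le.
rewrite Rabs_pos_eq in HN.
2:{ apply pow_le, Rmult_le_pos; [exact Ha0|]. left. apply Rinv_0_lt_compat. lra. }
unfold Rdiv at 1 in HN. rewrite Rpow_mult_distr, pow_inv in HN.
apply (Rmult_lt_compat_r (b ^ N * (M + 1))) in HN; [|apply Rmult_lt_0_compat; lra].
replace (a ^ N * / b ^ N * (b ^ N * (M + 1))) with (a ^ N * (M + 1)) in HN by (field; lra).
replace (h x / 2 * d / (M + 1) * (b ^ N * (M + 1))) with (h x / 2 * b ^ N * d) in HN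
  by (field; lra).
nra.
Qed.

(** The one-sided bound of [bump_nonpos] applies to the real part of [u g] for every complex [u];
    taking [u] among [1], [-1], [Ci], [- Ci] forces both parts of [g x] to vanish. *)
Lemma zero_of_fourier_zero g x : 0 < x < 1 -> ccont g ->
  (forall k : Z, cint (fun t => g t * e (IZR k * t))%C 0) -> g x = 0.
Proof.
intros Hx Hc Hi.
assert (key : forall u : C, Re (u * g x) <= 0).
{ intros u. apply (bump_nonpos (fun t => Re (u * g t)) x Hx).
  - intros t. apply (ccont_mult (fun _ => u) g (ccont_const u) Hc t).
  - intros n.
    assert (H := cint_scal u _ _ (cint_bump g x Hi n 0)).
    destruct H as [H _]. rewrite Cmult_0_r in H. simpl (Re 0) in H.
    apply is_RInt_ext with (2 := H). intros t _.
    rewrite Rmult_0_l, e_0, <- RtoC_pow.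
    destruct u, (g t). unfold Cmult, RtoC; simpl. ring. }
assert (H1 := key 1). assert (H2 := key (-1)). assert (H3 := key Ci).
assert (H4 := key (- Ci)%C).
destruct (g x) as [p q]. unfold Ci, RtoC, Cmult, Copp in *; simpl in *.
f_equal; lra.
Qed.

Lemma Permutation_incl {T : Type} (L0 L : list T) :
  NoDup L0 -> incl L0 L -> exists M, Permutation L (L0 ++ M).
Proof.
intros HN. revert L. induction HN as [|x L0 Hx HN IH]; intros L Hi.
- now exists L.
- destruct (in_split x L) as [A [B E]]; [apply Hi; now left|]. subst L.
  destruct (IH (A ++ B)) as [M HM].
  + intros y Hy. assert (Hy' := Hi y (or_intror Hy)).
    apply in_app_or in Hy'. apply in_or_app. destruct Hy' as [?|[<-|?]]; tauto.
  + exists M. simpl. rewrite <- HM. symmetry. apply Permutation_middle.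
Qed.

Lemma lsum_permutation {T : Type} (a : T -> C) L M :
  Permutation L M -> lsum a L = lsum a M.
Proof. induction 1; simpl; [reflexivity|now f_equal|ring|congruence]. Qed.

(* The finite set [L0] depends on the majorant [f] only. *)
Lemma has_sum_uniform {T : Type} (f : T -> R) eps :
  (forall t, 0 <= f t) -> bounded_sums f -> 0 < eps ->
  exists L0, forall (a : T -> C) l L, (forall t, Cmod (a t) <= f t) -> has_sum a l ->
    NoDup L -> incl L0 L -> Cmod (l - lsum a L) <= eps.
Proof.
intros Hf Hb He.
destruct (has_sum_nonneg f Hf Hb) as [s Hs].
destruct (Hs (eps / 2)) as [L0 HL0]; [lra|].
exists L0. intros a l L Ha Hl HN Hi.
apply le_epsilon. intros eta Heta.
destruct (Hl eta Heta) as [L1 HL1].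
destruct (exists_NoDup (L ++ L1)) as [L2 [N2 E2]].
assert (I1 : incl L L2) by (intros y Hy; apply E2, in_or_app; auto).
assert (I2 : incl L1 L2) by (intros y Hy; apply E2, in_or_app; auto).
specialize (HL1 L2 N2 I2).
destruct (Permutation_incl L L2 HN I1) as [M HM].
rewrite (lsum_permutation _ _ _ HM), lsum_app in HL1.
assert (P1 := HL0 L HN Hi).
assert (P2 := HL0 L2 N2 (incl_tran Hi I1)).
rewrite (lsum_permutation _ _ _ HM), lsum_app in P2.
assert (HMr : lsum (fun t => RtoC (f t)) M = RtoC (lsumR f M)).
{ clear. induction M as [|y M IH]; simpl; [reflexivity|]. now rewrite RtoC_plus, IH. }
(* [M] is what [L2] has beyond [L]; the sums of [f] over [L] and over [L2] both lie within [eps / 2]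
   of [s]. *)
assert (HMb : lsumR f M <= eps).
{ assert (H0 : 0 <= lsumR f M) by now apply lsumR_ge_0.
  assert (H := Cmod_triangle (lsum (fun t => RtoC (f t)) L + lsum (fun t => RtoC (f t)) M - s)
    (- (lsum (fun t => RtoC (f t)) L - s))).
  rewrite Cmod_opp in H.
  replace (lsum (fun t => RtoC (f t)) L + lsum (fun t => RtoC (f t)) M - s
    + - (lsum (fun t => RtoC (f t)) L - s))%C with (lsum (fun t => RtoC (f t)) M) in H by ring.
  rewrite HMr in H at 1. rewrite Cmod_R, Rabs_pos_eq in H by exact H0. lra. }
assert (H1 := Cmod_lsum a f M Ha).
assert (H2 := Cmod_triangle (lsum a M) (- (lsum a L + lsum a M - l))).
rewrite Cmod_opp in H2.
replace (lsum a M + - (lsum a L + lsum a M - l))%C with (l - lsum a L)%C in H2 by ring.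
lra.
Qed.

Lemma ccont_uniform_limit G :
  (forall eps, 0 < eps -> exists g, ccont g /\ forall t, Cmod (G t - g t) <= eps) -> ccont G.
Proof.
intros H.
assert (key : forall P : C -> R, (forall y z, P (y + z)%C = P y + P z) ->
  (forall z, P (- z)%C = - P z) ->
  (forall z, Rabs (P z) <= Cmod z) ->
  (forall g, ccont g -> forall t, continuous (fun t => P (g t)) t) ->
  forall t, continuous (fun t => P (G t)) t).
{ intros P P1 P1' P2 P3 t. apply filterlim_locally. intros eps.
  destruct (H (eps / 3)) as [g [Hg HG]]; [assert (h := cond_pos eps); lra|].
  assert (Hp : 0 < eps / 3) by (assert (h := cond_pos eps); lra).
  assert (Hc := proj1 (filterlim_locally _ _) (P3 g Hg t) (mkposreal _ Hp)).
  apply filter_imp with (2 := Hc). intros u Hu.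
  unfold ball in *; simpl in *. unfold AbsRing_ball, abs, minus, plus, opp in *; simpl in *.
  assert (Q1 := Rle_trans _ _ _ (P2 _) (HG t)).
  assert (Q2 := Rle_trans _ _ _ (P2 _) (HG u)).
  unfold Cminus in Q1, Q2. rewrite P1, P1' in Q1, Q2.
  apply Rabs_le_between in Q1, Q2. apply Rabs_def2 in Hu.
  apply Rabs_def1; lra. }
intros t. split.
- apply (key Re); [reflexivity|reflexivity|apply re_le_Cmod|]. intros g Hg u. apply Hg.
- apply (key Im); [reflexivity|reflexivity|apply Im_le_Cmod|]. intros g Hg u. apply Hg.
Qed.

Lemma cint_Cexp (z : C) : z <> 0 -> cint (fun t => Cexp (t * z)) ((Cexp z - 1) / z)%C.
Proof.
intros Hz. eapply cint_eq.
- apply cint_cderiv with (F := fun t => (/ z * Cexp (t * z))%C).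
  + intros t. eapply cderiv_eq; [apply cderiv_scal, cderiv_Cexp|]. field. exact Hz.
  + eapply ccont_cderiv. intros t. apply cderiv_Cexp.
- replace (1 * z)%C with z by ring. replace (0 * z)%C with (RtoC 0) by ring.
  rewrite Cexp_0. field. exact Hz.
Qed.

Lemma two_pi_i_neq_0 : (2 * PI * Ci)%C <> 0.
Proof.
apply Cmod_gt_0. rewrite !Cmod_mult, Cmod_Ci, !Cmod_R.
assert (HP := PI_RGT_0). rewrite !Rabs_pos_eq by lra. lra.
Qed.

Lemma RtoC_neq_0 (x : R) : x <> 0 -> RtoC x <> 0.
Proof. intros H E. apply H. now apply RtoC_inj. Qed.

Lemma two_pi_i_k_neq_0 (k : Z) : k <> 0%Z -> (2 * PI * Ci * IZR k)%C <> 0.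
Proof.
intros H. apply Cmult_neq_0; [apply two_pi_i_neq_0|]. apply RtoC_neq_0.
now apply eq_IZR_contrapositive.
Qed.

Lemma Cexp_2pi_i_k k : Cexp (2 * PI * Ci * IZR k) = 1.
Proof. rewrite <- e_Cexp. apply e_Z. Qed.

Lemma cint_e (k : Z) : cint (fun t => e (IZR k * t)) (if Z.eq_dec k 0 then 1 else 0).
Proof.
destruct (Z.eq_dec k 0) as [->|H].
- apply cint_ext with (fun _ => RtoC 1); [|apply cint_const].
  intros t. now rewrite Rmult_0_l, e_0.
- eapply cint_ext; [intros t; symmetry; apply e_Cexp_lin|].
  eapply cint_eq; [apply cint_Cexp, two_pi_i_k_neq_0, H|].
  rewrite Cexp_2pi_i_k. unfold Cdiv. ring.
Qed.

Lemma lsum_delta (c : Z -> C) j L : NoDup L -> In j L ->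
  lsum (fun k => c k * (if Z.eq_dec (k - j) 0 then 1 else 0))%C L = c j.
Proof.
assert (H0 : forall M, ~ In j M ->
  lsum (fun k => c k * (if Z.eq_dec (k - j) 0 then 1 else 0))%C M = 0).
{ induction M as [|y M IH]; intros H; simpl; [reflexivity|].
  simpl in H. rewrite IH by tauto.
  destruct (Z.eq_dec (y - j) 0); [|ring]. exfalso. apply H. left. lia. }
induction 1 as [|x L Hx HN IH]; intros Hj; [destruct Hj|]. simpl.
destruct Hj as [->|Hj].
- rewrite H0 by exact Hx. destruct (Z.eq_dec (j - j) 0); [ring|lia].
- rewrite IH by exact Hj. destruct (Z.eq_dec (x - j) 0); [|ring].
  exfalso. apply Hx. replace x with j by lia. exact Hj.
Qed.

(** The series converges uniformly to a continuous [G], whose Fourier coefficients are again the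
    [c k]. Hence [f - G] has vanishing coefficients and is zero at interior points. *)
Theorem fourier_inversion (f : R -> C) (c : Z -> C) (A x : R) :
  ccont f -> (forall k, cint (fun t => f t * e (IZR (- k) * t))%C (c k)) ->
  (forall k, Cmod (c k) <= A * decay k) -> 0 < x < 1 ->
  has_sum (fun k => c k * e (IZR k * x))%C (f x).
Proof.
intros Hf Hi HA Hx.
assert (HA0 : forall k, 0 <= A * decay k).
{ intros k. eapply Rle_trans; [apply Cmod_ge_0|apply HA]. }
assert (HA1 : 0 <= A).
{ specialize (HA0 0%Z). assert (H := decay_pos 0). nra. }
assert (Hb : bounded_sums (fun k => A * decay k)).
{ apply bounded_sums_scal; [exact HA1|apply bounded_sums_decay]. }
assert (Hbd : forall t k, Cmod (c k * e (IZR k * t)) <= A * decay k).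
{ intros t k. rewrite Cmod_mult, Cmod_e, Rmult_1_r. apply HA. }
(* The sum is known only to exist for each [t]; a choice turns it into a function. *)
set (G := fun t => proj1_sig (constructive_indefinite_description _
  (has_sum_exists (fun k => c k * e (IZR k * t))%C _ (Hbd t) Hb))).
assert (HG : forall t, has_sum (fun k => c k * e (IZR k * t))%C (G t)).
{ intros t. unfold G. apply proj2_sig. }
clearbody G.
set (S := fun L t => lsum (fun k => c k * e (IZR k * t))%C L).
assert (HU : forall eps, 0 < eps -> exists L0, forall L, NoDup L -> incl L0 L ->
  forall t, Cmod (G t - S L t) <= eps).
{ intros eps He. destruct (has_sum_uniform (fun k => A * decay k) eps HA0 Hb He) as [L0 HL0].
  exists L0. intros L HN HI t. now apply HL0. }
assert (HSc : forall L, ccont (S L)).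
{ intros L. apply ccont_lsum. intros k. apply ccont_mult; [apply ccont_const|apply ccont_e]. }
assert (HGc : ccont G).
{ apply ccont_uniform_limit. intros eps He. destruct (HU eps He) as [L0 HL0].
  destruct (exists_NoDup L0) as [L [HN HL]].
  exists (S L). split; [apply HSc|]. apply HL0; [exact HN|]. intros y Hy. now apply HL. }
assert (Hz : (f x - G x)%C = 0).
{ apply (zero_of_fourier_zero (fun t => f t - G t)%C x Hx).
  - now apply ccont_minus.
  (* Integration against the frequency [k] picks out the coefficient of index [- k]. *)
  - intros k. set (j := (- k)%Z).
    destruct (cint_exists (fun t => (f t - G t) * e (IZR k * t))%C) as [v Hv].
    { apply ccont_mult; [now apply ccont_minus|apply ccont_e]. }
    apply cint_eq with (1 := Hv). apply Cmod_eq_0.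
    apply Rle_antisym; [|apply Cmod_ge_0]. apply le_epsilon. intros eps He.
    destruct (HU (eps / 2)) as [L0 HL0]; [lra|].
    destruct (exists_NoDup (j :: L0)) as [L [HN HL]].
    specialize (HL0 L HN (fun y Hy => proj2 (HL y) (or_intror Hy))).
    assert (Hj : In j L) by (apply HL; now left).
    assert (Hs : cint (fun t => S L t * e (IZR k * t))%C (c j)).
    { apply cint_ext with (fun t => lsum (fun i => c i * e (IZR (i - j) * t))%C L).
      - intros t. unfold S. rewrite Cmult_comm, <- lsum_scal. apply lsum_ext. intros i _.
        unfold j. rewrite minus_IZR, opp_IZR.
        replace ((IZR i - - IZR k) * t) with (IZR i * t + IZR k * t) by ring.
        rewrite e_plus. ring.
      - eapply cint_eq; [|apply (lsum_delta c j L HN Hj)].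
        apply cint_lsum. intros i. apply cint_scal, cint_e. }
    assert (Hfj := Hi j). replace (- j)%Z with k in Hfj by (unfold j; lia).
    (* The integral of [f - S L] against this frequency is [c j - c j = 0]. Subtracting it from [v]
       leaves only [G - S L] in the integrand, which is uniformly small. *)
    assert (Hd := cint_minus _ _ _ _ Hv (cint_minus _ _ _ _ Hfj Hs)).
    replace (v - (c j - c j))%C with v in Hd by ring.
    replace (0 + eps) with (2 * (eps / 2)) by field.
    apply cint_bound with (2 := Hd). intros t.
    replace ((f t - G t) * e (IZR k * t) - (f t * e (IZR k * t) - S L t * e (IZR k * t)))%C
      with (- ((G t - S L t) * e (IZR k * t)))%C by ring.
    rewrite Cmod_opp, Cmod_mult, Cmod_e, Rmult_1_r. apply HL0. }
replace (f x) with (G x); [apply HG|].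
replace (f x) with (f x - G x + G x)%C by ring. rewrite Hz. ring.
Qed.


(** * The three Fourier series *)

Lemma inv_sqr_le_decay k : / (1 + Rabs (IZR k)) ^ 2 <= decay k.
Proof.
assert (H := Rabs_pos (IZR k)). unfold decay. set (y := 1 + Rabs (IZR k)).
assert (Hy : 1 <= y) by (unfold y; lra).
assert (Hs : 0 < sqrt y) by (apply sqrt_lt_R0; lra).
assert (Hq : sqrt y * sqrt y = y) by (apply sqrt_sqrt; lra).
apply Rinv_le_contravar; [apply Rmult_lt_0_compat; lra|]. simpl. nra.
Qed.

(** The real part of [M w + i K] is [M Re w], which controls [M]; the triangle inequality then
    controls [K] at the cost of a multiple of [Cmod w]. Adding the two estimates gives the
    constant. *)
Lemma lattice_lower (w : C) : Re w <> 0 ->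
  exists c, 0 < c /\ forall M K : R, c * (Rabs M + Rabs K) <= Cmod (M * w + Ci * K).
Proof.
intros Hw. assert (Hr := Rabs_pos_lt _ Hw). set (r := Rabs (Re w)) in *.
assert (H0 := Cmod_ge_0 w).
exists (r / (1 + r + Cmod w)). split; [apply Rdiv_lt_0_compat; lra|].
intros M K. set (A := Cmod (M * w + Ci * K)).
assert (H1 : Rabs M * r <= A).
{ unfold r. rewrite <- Rabs_mult.
  replace (M * Re w) with (Re (M * w + Ci * K)); [apply re_le_Cmod|].
  destruct w as [a b]. unfold Ci, RtoC, Cmult, Cplus; simpl. ring. }
assert (H2 : Rabs K <= A + Rabs M * Cmod w).
{ assert (H := Cmod_triangle (M * w + Ci * K) (- (M * w))).
  replace (M * w + Ci * K + - (M * w))%C with (Ci * K)%C in H by ring.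
  rewrite Cmod_opp, !Cmod_mult, Cmod_Ci, !Cmod_R in H. fold A in H. lra. }
apply Rmult_le_reg_r with (1 + r + Cmod w); [lra|].
replace (r / (1 + r + Cmod w) * (Rabs M + Rabs K) * (1 + r + Cmod w))
  with (r * (Rabs M + Rabs K)) by (field; lra).
assert (Rabs M * r * Cmod w <= A * Cmod w) by now apply Rmult_le_compat_r.
nra.
Qed.

Lemma lattice_neq_0 (w : C) (M K : R) : Re w <> 0 -> M <> 0 -> (M * w + Ci * K)%C <> 0.
Proof.
intros Hw HM. destruct (lattice_lower w Hw) as [c [Hc H]].
apply Cmod_gt_0. specialize (H M K).
assert (H1 := Rabs_pos_lt _ HM). assert (H2 := Rabs_pos K).
assert (0 < c * (Rabs M + Rabs K)) by (apply Rmult_lt_0_compat; lra). lra.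
Qed.

Lemma Rabs_IZR_ge_1 k : k <> 0%Z -> 1 <= Rabs (IZR k).
Proof.
intros H. rewrite <- abs_IZR. apply IZR_le. lia.
Qed.

(** The difference is [- i] over the product of two consecutive denominators. Passing from [K] to
    [K - 1] loses at most half of [|M| + |K|], because [|M| >= 1]; this is the [2] in the
    constant. *)
Lemma lattice_diff_bound (w : C) : Re w <> 0 -> exists B, 0 < B /\
  forall M K : Z, M <> 0%Z ->
  Cmod (/ (IZR M * w + Ci * IZR K) - / (IZR M * w + Ci * IZR (K - 1)))
    <= B / (Rabs (IZR M) + Rabs (IZR K)) ^ 2.
Proof.
intros Hw. destruct (lattice_lower w Hw) as [c [Hc H]].
exists (2 / c ^ 2). split; [apply Rdiv_lt_0_compat; [lra|now apply pow_lt]|].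
intros M K HM. assert (HM' : IZR M <> 0) by now apply eq_IZR_contrapositive.
assert (N1 := lattice_neq_0 w (IZR M) (IZR K) Hw HM').
assert (N2 := lattice_neq_0 w (IZR M) (IZR (K - 1)) Hw HM').
replace (/ (IZR M * w + Ci * IZR K) - / (IZR M * w + Ci * IZR (K - 1)))%C
  with (- Ci * / ((IZR M * w + Ci * IZR K) * (IZR M * w + Ci * IZR (K - 1))))%C.
2:{ rewrite minus_IZR, RtoC_minus in N2 |- *. field. now split. }
rewrite Cmod_mult, Cmod_opp, Cmod_Ci, Rmult_1_l, Cmod_inv, Cmod_mult
  by now apply Cmult_neq_0.
assert (H1 := H (IZR M) (IZR K)). assert (H2 := H (IZR M) (IZR (K - 1))).
assert (H3 := Rabs_IZR_ge_1 M HM). assert (H4 := Rabs_pos (IZR K)).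
assert (H5 : Rabs (IZR K) <= Rabs (IZR (K - 1)) + 1).
{ rewrite minus_IZR. assert (T := Rabs_triang (IZR K - 1) 1).
  replace (IZR K - 1 + 1) with (IZR K) in T by ring. rewrite Rabs_R1 in T. lra. }
set (S := Rabs (IZR M) + Rabs (IZR K)) in *.
assert (HS : 1 <= S) by (unfold S; lra).
replace (2 / c ^ 2 / S ^ 2) with (/ ((c * S) * (c * (S / 2)))) by (field; lra).
assert (0 < c * S) by (apply Rmult_lt_0_compat; lra).
assert (0 < c * (S / 2)) by (apply Rmult_lt_0_compat; lra).
apply Rinv_le_contravar; [now apply Rmult_lt_0_compat|].
apply Rmult_le_compat; try lra.
eapply Rle_trans; [|exact H2]. apply Rmult_le_compat_l; [lra|]. unfold S.
assert (H8 := Rabs_pos (IZR (K - 1))). lra.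
Qed.

(** Repeated integration by parts. As [Cexp z = 1], only the jumps between the endpoints survive:
    [a + b] for the polynomial and [2 a] for its derivative. *)
Lemma cint_poly (a b d z : C) : z <> 0 -> Cexp z = 1 ->
  cint (fun t => (a * RtoC t ^ 2 + b * RtoC t + d) * Cexp (t * z))%C
    ((a + b) / z - 2 * a / z ^ 2)%C.
Proof.
intros Hz Hz1.
assert (Hp : forall t, cderiv (fun t => a * RtoC t ^ 2 + b * RtoC t + d)%C t (2 * a * t + b)%C).
{ intros t. eapply cderiv_eq.
  - apply cderiv_plus; [|apply cderiv_const].
    apply cderiv_plus; [apply cderiv_scal, (cderiv_pow 1)|apply cderiv_scal, cderiv_id].
  - simpl. replace (1 + 1) with 2 by ring. ring. }
assert (Hq : forall t, cderiv (fun t => 2 * a * RtoC t + b)%C t (2 * a)%C).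
{ intros t. eapply cderiv_eq.
  - apply cderiv_plus; [apply cderiv_scal, cderiv_id|apply cderiv_const].
  - ring. }
eapply cint_eq.
- apply cint_cderiv with (F := fun t => (((/ z) * (a * RtoC t ^ 2 + b * RtoC t + d)
    + ((- / z ^ 2) * (2 * a * RtoC t + b) + 2 * a / z ^ 3)) * Cexp (t * z))%C).
  + intros t. eapply cderiv_eq.
    * apply cderiv_mult; [|apply cderiv_Cexp].
      apply cderiv_plus; [apply cderiv_scal, Hp|].
      apply cderiv_plus; [apply cderiv_scal, Hq|apply cderiv_const].
    * cbv beta. field. exact Hz.
  + apply ccont_mult; eapply ccont_cderiv; [apply Hp|intros t; apply cderiv_Cexp].
- replace (1 * z)%C with z by ring. replace (0 * z)%C with (RtoC 0) by ring.
  rewrite Cexp_0, Hz1. field. exact Hz.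
Qed.

(* At [k = 0] this is the junk value [/ 0 = 0], which is the wanted Fourier
   coefficient. *)
Definition invZ (k : Z) : C := RtoC (/ IZR k).

Lemma invZ_0 : invZ 0 = 0.
Proof. unfold invZ. now rewrite Rinv_0. Qed.

Lemma invZ_neq k : k <> 0%Z -> invZ k = (/ IZR k)%C.
Proof. intros H. unfold invZ. apply RtoC_inv. now apply eq_IZR_contrapositive. Qed.

Lemma invZ_opp k : invZ (- k) = (- invZ k)%C.
Proof. unfold invZ. now rewrite opp_IZR, Rinv_opp, RtoC_opp. Qed.

Lemma Ci_neq_0 : Ci <> 0.
Proof. apply Cmod_gt_0. rewrite Cmod_Ci. lra. Qed.

Lemma Ci_sqr : (Ci * Ci)%C = (- (1))%C.
Proof. unfold Ci, Cmult, RtoC, Copp; simpl; f_equal; ring. Qed.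

Lemma RtoC_PI_neq_0 : RtoC PI <> 0.
Proof. apply RtoC_neq_0, PI_neq0. Qed.

Lemma cint_B1 (k : Z) :
  cint (fun t => (RtoC t - 1 / 2) * e (IZR k * t))%C (invZ k / (2 * PI * Ci))%C.
Proof.
destruct (Z.eq_dec k 0) as [->|H].
- apply cint_ext with (fun t => (RtoC t - 1 / 2)%C).
  { intros t. rewrite Rmult_0_l, e_0. ring. }
  rewrite invZ_0. eapply cint_eq.
  + apply cint_cderiv with (F := fun t => (1 / 2 * RtoC t ^ 2 + (- (1 / 2)) * RtoC t)%C).
    * intros t. eapply cderiv_eq.
      -- apply cderiv_plus; [apply cderiv_scal, (cderiv_pow 1)|apply cderiv_scal, cderiv_id].
      -- simpl. replace (1 + 1) with 2 by ring. field.
    * apply ccont_minus; [|apply ccont_const]. eapply ccont_cderiv. apply cderiv_id.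
  + field. split; [apply Ci_neq_0|apply RtoC_PI_neq_0].
- eapply cint_ext; [|eapply cint_eq;
    [apply (cint_poly 0 1 (- (1 / 2))%C _ (two_pi_i_k_neq_0 k H) (Cexp_2pi_i_k k))|]].
  + intros t. cbv beta. rewrite e_Cexp_lin. field.
  + rewrite invZ_neq by exact H.
    assert (H1 := two_pi_i_k_neq_0 k H). assert (H2 := two_pi_i_neq_0).
    assert (H3 : RtoC (IZR k) <> 0) by now apply RtoC_neq_0, eq_IZR_contrapositive.
    set (u := (2 * PI * Ci)%C) in *. field. now split.
Qed.

Lemma cint_B2 (k : Z) :
  cint (fun t => (RtoC t ^ 2 - RtoC t + 1 / 6) * e (IZR k * t))%C
    (invZ k ^ 2 / (2 * PI ^ 2))%C.
Proof.
assert (HP := RtoC_PI_neq_0).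
destruct (Z.eq_dec k 0) as [->|H].
- apply cint_ext with (fun t => (RtoC t ^ 2 - RtoC t + 1 / 6)%C).
  { intros t. rewrite Rmult_0_l, e_0. ring. }
  rewrite invZ_0. eapply cint_eq.
  + apply cint_cderiv with
      (F := fun t => (1 / 3 * RtoC t ^ 3 + ((- (1 / 2)) * RtoC t ^ 2 + 1 / 6 * RtoC t))%C).
    * intros t. eapply cderiv_eq.
      -- apply cderiv_plus; [apply cderiv_scal, (cderiv_pow 2)|].
         apply cderiv_plus; [apply cderiv_scal, (cderiv_pow 1)|apply cderiv_scal, cderiv_id].
      -- simpl. replace (1 + 1 + 1) with 3 by ring. replace (1 + 1) with 2 by ring. field.
    * apply ccont_plus; [|apply ccont_const].
      apply ccont_minus; eapply ccont_cderiv; [apply (cderiv_pow 1)|apply cderiv_id].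
  + field. exact HP.
- eapply cint_ext; [|eapply cint_eq;
    [apply (cint_poly 1 (- (1))%C (1 / 6)%C _ (two_pi_i_k_neq_0 k H) (Cexp_2pi_i_k k))|]].
  + intros t. cbv beta. rewrite e_Cexp_lin. field.
  + rewrite invZ_neq by exact H.
    assert (H3 : RtoC (IZR k) <> 0) by now apply RtoC_neq_0, eq_IZR_contrapositive.
    assert (H1 := two_pi_i_k_neq_0 k H).
    replace ((1 + - (1)) / (2 * PI * Ci * IZR k) - 2 * 1 / (2 * PI * Ci * IZR k) ^ 2)%C
      with (- (2) / (4 * (PI * PI) * (Ci * Ci) * (IZR k * IZR k)))%C.
    * rewrite Ci_sqr. field. now split.
    * field. repeat split; trivial. apply Ci_neq_0.
Qed.

(** [B_2] takes equal values at [0] and [1], so its coefficients decay quadratically and no factor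
    [1 - e x] is needed here. The constant [4] comes from [1 + |k| <= 2 |k|]. *)
Lemma has_sum_B2 x : 0 < x < 1 ->
  has_sum (fun k => invZ k ^ 2 * e (IZR k * x))%C (2 * PI ^ 2 * (x ^ 2 - x + 1 / 6))%C.
Proof.
intros Hx.
assert (HP := RtoC_PI_neq_0).
apply (fourier_inversion (fun t => 2 * PI ^ 2 * (RtoC t ^ 2 - RtoC t + 1 / 6))%C) with (A := 4).
- apply ccont_mult; [apply ccont_const|].
  apply ccont_plus; [|apply ccont_const].
  apply ccont_minus; eapply ccont_cderiv; [apply (cderiv_pow 1)|apply cderiv_id].
- intros k. eapply cint_ext; [|eapply cint_eq;
    [exact (cint_scal (2 * PI ^ 2) _ _ (cint_B2 (- k)))|]].
  + intros t. cbv beta. ring.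
  + rewrite invZ_opp. field. exact HP.
- intros k. assert (Hd := decay_pos k).
  destruct (Z.eq_dec k 0) as [->|H].
  { rewrite invZ_0. simpl. rewrite Cmult_0_l, Cmod_0. lra. }
  eapply Rle_trans; [|apply Rmult_le_compat_l; [lra|apply inv_sqr_le_decay]].
  unfold invZ. rewrite Cmod_pow, Cmod_R, Rabs_inv.
  assert (H1 := Rabs_IZR_ge_1 k H). set (y := Rabs (IZR k)) in *.
  replace (4 * / (1 + y) ^ 2) with ((2 / (1 + y)) ^ 2) by (field; lra).
  apply pow_incr. split; [left; apply Rinv_0_lt_compat; lra|].
  apply Rmult_le_reg_r with (y * (1 + y)); [apply Rmult_lt_0_compat; lra|].
  replace (/ y * (y * (1 + y))) with (1 + y) by (field; lra).
  replace (2 / (1 + y) * (y * (1 + y))) with (2 * y) by (field; lra). lra.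
- exact Hx.
Qed.

Lemma invZ_diff_bound k : Cmod (invZ k - invZ (k - 1)) <= 6 * decay k.
Proof.
eapply Rle_trans; [|apply Rmult_le_compat_l; [lra|apply inv_sqr_le_decay]].
(* At [k = 0] and [k = 1] the convention [invZ 0 = 0] enters and the difference is [1]; elsewhere it
   is [- 1 / (k (k - 1))]. *)
destruct (Z.eq_dec k 0) as [->|H0].
{ rewrite invZ_0. replace (0 - invZ (0 - 1))%C with (RtoC 1).
  - rewrite Cmod_1, Rabs_R0. lra.
  - rewrite invZ_neq by lia. simpl. field. }
destruct (Z.eq_dec k 1) as [->|H1].
{ simpl. rewrite invZ_0. replace (invZ 1 - 0)%C with (RtoC 1).
  - rewrite Cmod_1, Rabs_R1. lra.
  - rewrite invZ_neq by lia. field. }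
unfold invZ. rewrite <- RtoC_minus, Cmod_R, minus_IZR.
assert (N0 : IZR k <> 0) by now apply eq_IZR_contrapositive.
assert (N1 : IZR k - 1 <> 0).
{ rewrite <- minus_IZR. apply eq_IZR_contrapositive. lia. }
replace (/ IZR k - / (IZR k - 1)) with (- / (IZR k * (IZR k - 1))) by (field; now split).
rewrite Rabs_Ropp, Rabs_inv, Rabs_mult.
replace (6 * / (1 + Rabs (IZR k)) ^ 2) with (/ ((1 + Rabs (IZR k)) ^ 2 / 6)).
2:{ assert (H := Rabs_pos (IZR k)). field. lra. }
apply Rinv_le_contravar.
{ assert (H := Rabs_pos (IZR k)). assert (0 < (1 + Rabs (IZR k)) ^ 2) by (apply pow_lt; lra). lra. }
destruct (Z_lt_le_dec k 0) as [Hk|Hk].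
- assert (IZR k <= -1) by now apply IZR_le; lia.
  rewrite !Rabs_left by lra. nra.
- assert (2 <= IZR k) by now apply IZR_le; lia.
  rewrite !Rabs_pos_eq by lra. nra.
Qed.

(** [2 PI i B_1] has the coefficients [- 1 / k], hence the sign; its jump at the integers is
    cancelled by the zero of [1 - e x], so the differenced coefficients are summable. *)
Lemma has_sum_B1 x : 0 < x < 1 ->
  has_sum (fun k => (invZ k - invZ (k - 1)) * e (IZR k * x))%C
    (- (1 - e x) * (2 * PI * Ci * (x - 1 / 2)))%C.
Proof.
intros Hx.
set (f := fun t : R => ((e (1 * t) - 1) * (2 * PI * Ci * (RtoC t - 1 / 2)))%C).
replace (- (1 - e x) * (2 * PI * Ci * (x - 1 / 2)))%C with (f x).
2:{ unfold f. rewrite Rmult_1_l. ring. }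
apply fourier_inversion with (A := 6).
- apply ccont_mult; [apply ccont_minus; [apply ccont_e|apply ccont_const]|].
  apply ccont_mult; [apply ccont_const|].
  apply ccont_minus; [eapply ccont_cderiv, cderiv_id|apply ccont_const].
- intros k. eapply cint_ext; [|eapply cint_eq;
    [exact (cint_scal (2 * PI * Ci) _ _ (cint_minus _ _ _ _ (cint_B1 (1 - k)) (cint_B1 (- k))))|]].
  + intros t. cbv beta. unfold f.
    replace (IZR (1 - k) * t) with (1 * t + IZR (- k) * t).
    * rewrite e_plus. ring.
    * rewrite minus_IZR, opp_IZR. ring.
  + replace (1 - k)%Z with (- (k - 1))%Z by lia. rewrite !invZ_opp. field.
    split; [apply Ci_neq_0|apply RtoC_PI_neq_0].
- apply invZ_diff_bound.
- exact Hx.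
Qed.

Lemma one_minus_Cexp_neq_0 z : Re z <> 0 -> (1 - Cexp z)%C <> 0.
Proof.
intros Hz E. assert (E1 : Cexp z = 1).
{ replace (Cexp z) with (1 - (1 - Cexp z))%C by ring. rewrite E. ring. }
assert (E2 := Cmod_Cexp z). rewrite E1, Cmod_1 in E2.
apply Hz. apply exp_inv. now rewrite exp_0.
Qed.

(** The function [E s] for [alpha = x]. For [Re s > 0] it is the sum of [exp (- 2 pi (n + x) s)]
    over [n >= 0]. *)
Definition geom_ratio (x : R) (s : C) : C :=
  (Cexp (x * (- (2 * PI) * s)) / (1 - Cexp (- (2 * PI) * s)))%C.

(** Between [x = 0] and [x = 1] the function [geom_ratio] drops by exactly [1]; the factor [1 - e x]
    closes this jump, leaving quadratically decaying coefficients. *)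
Lemma has_sum_geom_ratio x s : 0 < x < 1 -> Re s <> 0 ->
  has_sum (fun k => (/ (s + Ci * IZR k) - / (s + Ci * IZR (k - 1))) * e (IZR k * x))%C
    ((1 - e x) * (2 * PI * geom_ratio x s))%C.
Proof.
intros Hx Hs.
assert (HP := RtoC_PI_neq_0).
assert (HP0 := PI_RGT_0).
assert (Hn : forall k : R, (s + Ci * k)%C <> 0).
{ intros k. replace s with (1 * s)%C by ring. apply lattice_neq_0; [exact Hs|lra]. }
assert (Hd : (1 - Cexp (- (2 * PI) * s))%C <> 0).
{ apply one_minus_Cexp_neq_0.
  replace (Re (- (2 * PI) * s)) with (- (2 * PI) * Re s).
  - apply Rmult_integral_contrapositive. split; [lra|exact Hs].
  - destruct s as [a b]. unfold RtoC, Cmult, Copp; simpl. ring. }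
destruct (lattice_diff_bound s Hs) as [B [HB HL]].
set (f := fun t : R => ((1 - e (1 * t)) * (2 * PI * geom_ratio t s))%C).
replace ((1 - e x) * (2 * PI * geom_ratio x s))%C with (f x).
2:{ unfold f. now rewrite Rmult_1_l. }
apply fourier_inversion with (A := B).
- apply ccont_mult; [apply ccont_minus; [apply ccont_const|apply ccont_e]|].
  apply ccont_mult; [apply ccont_const|].
  apply ccont_mult; [eapply ccont_cderiv; intros t; apply cderiv_Cexp|apply ccont_const].
- intros k. set (D := (1 - Cexp (- (2 * PI) * s))%C) in *.
  assert (Hz : forall j : Z, (- (2 * PI) * (s + Ci * IZR j))%C <> 0).
  { intros j. apply Cmult_neq_0; [|apply Hn].
    rewrite <- RtoC_mult, <- RtoC_opp. apply RtoC_neq_0. lra. }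
  (* Independent of [j]: every integral therefore has the numerator [- D], which cancels the
     denominator of [geom_ratio]. *)
  assert (HE : forall j : Z, Cexp (- (2 * PI) * (s + Ci * IZR j)) = (1 - D)%C).
  { intros j. unfold D.
    replace (- (2 * PI) * (s + Ci * IZR j))%C
      with (- (2 * PI) * s + 2 * PI * Ci * IZR (- j))%C by (rewrite opp_IZR, RtoC_opp; ring).
    rewrite Cexp_plus, Cexp_2pi_i_k. ring. }
  eapply cint_ext; [|eapply cint_eq;
    [exact (cint_scal (2 * PI / D) _ _ (cint_minus _ _ _ _
      (cint_Cexp _ (Hz k)) (cint_Cexp _ (Hz (k - 1)%Z))))|]].
  + intros t. cbv beta. unfold f, geom_ratio. fold D.
    rewrite !e_Cexp_lin.
    replace (Cexp (t * (- (2 * PI) * (s + Ci * IZR k)))) with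
      (Cexp (t * (- (2 * PI) * s)) * Cexp (t * (2 * PI * Ci * IZR (- k))))%C.
    2:{ rewrite <- Cexp_plus. f_equal. rewrite opp_IZR, RtoC_opp. ring. }
    replace (Cexp (t * (- (2 * PI) * (s + Ci * IZR (k - 1))))) with
      (Cexp (t * (- (2 * PI) * s)) * (Cexp (t * (2 * PI * Ci * 1))
       * Cexp (t * (2 * PI * Ci * IZR (- k)))))%C.
    2:{ rewrite <- !Cexp_plus. f_equal. rewrite opp_IZR, RtoC_opp, minus_IZR, RtoC_minus. ring. }
    field. exact Hd.
  + rewrite !HE. assert (N1 := Hn (IZR k)). assert (N2 := Hn (IZR (k - 1))).
    field. repeat split; trivial.
- intros k. assert (H := HL 1%Z k ltac:(lia)).
  replace (1 * s)%C with s in H by ring. eapply Rle_trans; [exact H|].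
  rewrite Rabs_R1. unfold Rdiv. apply Rmult_le_compat_l; [lra|apply inv_sqr_le_decay].
- exact Hx.
Qed.


(** * Lambda as a Lambert series *)

(** Both are iterated sums of the family [(z q ^ n) ^ (m + 1) / (m + 1)], which is dominated by
    [|q| ^ n |z| ^ m]: summing over [m] gives logarithms, and summing over [n] gives geometric
    series. *)
Lemma lambert_series (z q : C) : Cmod z < 1 -> Cmod q < 1 ->
  exists l, has_sum (fun n => - Clog (1 - z * q ^ n))%C l /\
    has_sum (fun m => z ^ S m / INR (S m) * / (1 - q ^ S m))%C l.
Proof.
intros Hz Hq.
assert (Hz0 := Cmod_ge_0 z). assert (Hq0 := Cmod_ge_0 q).
assert (HI : forall m, 1 <= INR (S m)) by (intros m; rewrite S_INR; assert (H := pos_INR m); lra).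
assert (HIC : forall m, RtoC (INR (S m)) <> 0).
{ intros m. apply RtoC_neq_0. specialize (HI m). lra. }
assert (Hpow : forall y n, 0 <= y -> y < 1 -> 0 <= y ^ n <= 1).
{ intros y n H0 H1. split; [now apply pow_le|]. rewrite <- (pow1 n). apply pow_incr. lra. }
set (a := fun p : nat * nat => ((z * q ^ fst p) ^ S (snd p) / INR (S (snd p)))%C).
destruct (has_sum_exists a (fun p => Cmod q ^ fst p * Cmod z ^ snd p)) as [l Hl].
- intros [n m]. unfold a; cbn [fst snd].
  rewrite Cmod_div by apply HIC. rewrite Cmod_R, Rabs_pos_eq by (specialize (HI m); lra).
  rewrite Cmod_pow, Cmod_mult, Cmod_pow, Rpow_mult_distr.
  assert (B1 := Hpow _ n Hq0 Hq). assert (B2 := Hpow _ m Hz0 Hz).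
  assert (B3 := Hpow _ (S m) Hz0 Hz).
  assert (B4 : (Cmod q ^ n) ^ S m <= Cmod q ^ n).
  { simpl. assert (0 <= (Cmod q ^ n) ^ m <= 1); [|nra].
    split; [apply pow_le; lra|]. rewrite <- (pow1 m). apply pow_incr. lra. }
  assert (B5 : 0 <= (Cmod q ^ n) ^ S m) by (apply pow_le; lra).
  apply Rle_trans with (Cmod z ^ S m * (Cmod q ^ n) ^ S m).
  + assert (B6 : / INR (S m) <= 1).
    { rewrite <- Rinv_1. apply Rinv_le_contravar; [lra|apply HI]. }
    assert (B7 : 0 <= Cmod z ^ S m * (Cmod q ^ n) ^ S m) by (apply Rmult_le_pos; lra).
    unfold Rdiv. nra.
  + rewrite Rmult_comm. apply Rmult_le_compat; try lra.
    simpl. nra.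
- apply bounded_sums_prod; try (intros; apply pow_le; assumption);
    now apply bounded_sums_geom.
- exists l. split.
  + apply has_sum_fubini with (1 := Hl). intros n. unfold a; cbn [fst snd].
    apply has_sum_Clog. rewrite Cmod_mult, Cmod_pow.
    assert (B1 := Hpow _ n Hq0 Hq). nra.
  + apply has_sum_fubini with (a := fun p => a (snd p, fst p)).
    * apply has_sum_bijection with (p := fun p : nat * nat => (snd p, fst p))
        (q := fun p : nat * nat => (snd p, fst p)) (a := a);
        [now intros []|now intros []|now intros []|exact Hl].
    * intros m. unfold a; cbn [fst snd].
      apply has_sum_ext with (fun n => z ^ S m / INR (S m) * (q ^ S m) ^ n)%C.
      { intros n. rewrite Cpow_mult_l, <- !Cpow_mult_r, (Nat.mul_comm n). field. apply HIC. }
      apply has_sum_scal, has_sum_geom. rewrite Cmod_pow.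
      apply Rle_lt_trans with (2 := Hq). simpl.
      assert (B1 := Hpow _ m Hq0 Hq). nra.
Qed.

Definition lambda_coef (alpha gamma : R) (w : C) (M : Z) : C :=
  (invZ M * e (IZR M * gamma) * geom_ratio alpha (IZR M * w))%C.

Lemma Re_scal (x : R) (z : C) : Re (x * z) = x * Re z.
Proof. destruct z. unfold RtoC, Cmult; simpl. ring. Qed.

Lemma Cmod_Cexp_lt_1 (x : R) (w : C) : 0 < x -> 0 < Re w ->
  Cmod (Cexp (x * (- (2 * PI) * w))) < 1.
Proof.
intros Hx Hw. rewrite Cmod_Cexp, <- exp_0. apply exp_increasing.
assert (HP := PI_RGT_0).
rewrite <- RtoC_mult, <- RtoC_opp, !Re_scal.
assert (0 < x * (2 * PI * Re w)).
{ apply Rmult_lt_0_compat; [lra|]. apply Rmult_lt_0_compat; lra. }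
lra.
Qed.

Lemma e_pow x n : (e x ^ n)%C = e (INR n * x).
Proof.
rewrite !e_Cexp, <- Cexp_INR_mult, RtoC_mult. f_equal. ring.
Qed.

(** The first logarithms give the indices [M > 0] and the second ones [M < 0]: replacing [alpha] by
    [1 - alpha] turns [E s] into [- E (- s)], and this sign is absorbed by [1 / M]. *)
Lemma lambda_as_Z_sum alpha gamma w : 0 < Re w -> 0 < alpha < 1 ->
  exists F, has_sum (lambda_coef alpha gamma w) F /\
    has_sum (fun n =>
      Clog (1 - (e gamma * Cexp (alpha * (- (2 * PI) * w))) * Cexp (- (2 * PI) * w) ^ n) +
      Clog (1 - (e (- gamma) * Cexp ((1 - alpha)%R * (- (2 * PI) * w)))
        * Cexp (- (2 * PI) * w) ^ n))%C (- F)%C.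
Proof.
intros Hw Ha.
set (q := Cexp (- (2 * PI) * w)).
set (z := (e gamma * Cexp (alpha * (- (2 * PI) * w)))%C).
set (z' := (e (- gamma) * Cexp ((1 - alpha)%R * (- (2 * PI) * w)))%C).
assert (Hq : Cmod q < 1).
{ unfold q. replace (- (2 * PI) * w)%C with (1 * (- (2 * PI) * w))%C by ring.
  apply Cmod_Cexp_lt_1; lra. }
assert (Hz : Cmod z < 1).
{ unfold z. rewrite Cmod_mult, Cmod_e, Rmult_1_l. apply Cmod_Cexp_lt_1; lra. }
assert (Hz' : Cmod z' < 1).
{ unfold z'. rewrite Cmod_mult, Cmod_e, Rmult_1_l. apply Cmod_Cexp_lt_1; lra. }
destruct (lambert_series z q Hz Hq) as [l [H1 H2]].
destruct (lambert_series z' q Hz' Hq) as [l' [H3 H4]].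
exists (l + l')%C. split.
2:{ replace (- (l + l'))%C with ((-1) * (l + l'))%C by ring.
  eapply has_sum_ext; [|exact (has_sum_scal (-1) _ _ (has_sum_plus _ _ _ _ H1 H3))].
  intros n. cbv beta. ring. }
assert (HIC : forall m, RtoC (INR (S m)) <> 0).
{ intros m. apply RtoC_neq_0, not_0_INR. discriminate. }
assert (HqS : forall m, (1 - q ^ S m)%C <> 0).
{ intros m. unfold q. rewrite <- Cexp_INR_mult. apply one_minus_Cexp_neq_0.
  rewrite <- RtoC_mult, <- RtoC_opp, !Re_scal.
  assert (HP := PI_RGT_0). assert (0 < INR (S m)) by (apply lt_0_INR; lia).
  assert (0 < INR (S m) * (2 * PI * Re w)).
  { apply Rmult_lt_0_compat; [lra|]. apply Rmult_lt_0_compat; lra. }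
  lra. }
assert (HqE : forall m, Cexp (- (2 * PI) * (INR (S m) * w)) = (q ^ S m)%C).
{ intros m. unfold q. rewrite <- Cexp_INR_mult. f_equal. ring. }
apply has_sum_Z.
- unfold lambda_coef. rewrite invZ_0. ring.
- apply has_sum_ext with (2 := H2). intros m. unfold lambda_coef, geom_ratio.
  rewrite invZ_neq by lia. rewrite <- INR_IZR_INZ.
  rewrite HqE. unfold z. rewrite Cpow_mult_l, e_pow, <- Cexp_INR_mult.
  replace (INR (S m) * (alpha * (- (2 * PI) * w)))%C
    with (alpha * (- (2 * PI) * (INR (S m) * w)))%C by ring.
  field. split; [apply HqS|apply HIC].
- apply has_sum_ext with (2 := H4). intros m. unfold lambda_coef, geom_ratio.
  rewrite invZ_opp, invZ_neq by lia. rewrite opp_IZR, <- INR_IZR_INZ, RtoC_opp.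
  replace (- (2 * PI) * (- INR (S m) * w))%C with (- (- (2 * PI) * (INR (S m) * w)))%C by ring.
  rewrite Cexp_opp, HqE. unfold z'. rewrite Cpow_mult_l, e_pow, <- Cexp_INR_mult.
  replace (INR (S m) * - gamma) with (- INR (S m) * gamma) by ring.
  replace (INR (S m) * ((1 - alpha)%R * (- (2 * PI) * w)))%C
    with (- (2 * PI) * (INR (S m) * w) + alpha * - (- (2 * PI) * (INR (S m) * w)))%C
    by (rewrite RtoC_minus; ring).
  rewrite Cexp_plus, HqE.
  assert (N := HqS m). assert (N2 : (q ^ S m)%C <> 0) by apply Cpow_nz, Cexp_neq_0.
  assert (N3 : (q ^ S m - 1)%C <> 0).
  { intros E. apply N. replace (1 - q ^ S m)%C with (- (q ^ S m - 1))%C by ring.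
    rewrite E. ring. }
  set (Q := (q ^ S m)%C) in *. field. repeat split; trivial; apply HIC.
Qed.

(** * The double series *)

Definition ecoef (w : C) (M K : Z) : C :=
  (invZ M / (2 * PI) * / (IZR M * w + Ci * IZR K))%C.

Definition mixed_diff (c : Z -> Z -> C) (M K : Z) : C :=
  (c M K - c M (K - 1)%Z - (c (M - 1)%Z K - c (M - 1)%Z (K - 1)%Z))%C.

Lemma decay_prod_bound (M K : Z) : M <> 0%Z ->
  / Rabs (IZR M) * / (Rabs (IZR M) + Rabs (IZR K)) ^ 2 <= 4 * (decay M * decay K).
Proof.
intros HM. assert (HX := Rabs_IZR_ge_1 M HM). assert (HY := Rabs_pos (IZR K)).
unfold decay. set (X := Rabs (IZR M)) in *. set (Y := Rabs (IZR K)) in *.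
assert (Hp : 0 < sqrt (1 + X)) by (apply sqrt_lt_R0; lra).
assert (Hr : 0 < sqrt (1 + Y)) by (apply sqrt_lt_R0; lra).
assert (Ep : sqrt (1 + X) * sqrt (1 + X) = 1 + X) by (apply sqrt_sqrt; lra).
assert (Er : sqrt (1 + Y) * sqrt (1 + Y) = 1 + Y) by (apply sqrt_sqrt; lra).
set (p := sqrt (1 + X)) in *. set (r := sqrt (1 + Y)) in *.
replace (4 * (/ ((1 + X) * p) * / ((1 + Y) * r)))
  with (/ ((1 + X) * p * ((1 + Y) * r) / 4)) by (field; lra).
rewrite <- Rinv_mult. apply Rinv_le_contravar.
{ assert (0 < (1 + X) * p * ((1 + Y) * r)) by (repeat apply Rmult_lt_0_compat; lra). lra. }
assert (HS : p * r <= 2 * (X + Y)) by nra.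
replace ((1 + X) * p * ((1 + Y) * r) / 4) with ((1 + X) / 2 * ((1 + Y) * (p * r / 2))) by field.
(* As [X >= 1], the three factors are bounded by [(1 + X) / 2 <= X], by [1 + Y <= X + Y], and by
   [p r / 2 <= X + Y], the last from the inequality of arithmetic and geometric means. *)
assert (0 < p * r) by now apply Rmult_lt_0_compat.
apply Rmult_le_compat; try lra.
- apply Rmult_le_pos; lra.
- simpl. rewrite Rmult_1_r. apply Rmult_le_compat; lra.
Qed.

(** The difference in [K] alone makes the family [G] absolutely summable, and summing it over [K]
    first gives [(1 - e alpha) F]. The difference in [M] is then only a shift of an already
    convergent double sum. *)
Lemma has_sum_ecoef alpha gamma w F : 0 < Re w -> 0 < alpha < 1 ->
  has_sum (lambda_coef alpha gamma w) F ->
  has_sum (fun p : Z * Z => e (IZR (fst p) * gamma) * e (IZR (snd p) * alpha)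
      * mixed_diff (ecoef w) (fst p) (snd p))%C
    ((1 - e gamma) * (1 - e alpha) * F)%C.
Proof.
intros Hw Ha HF.
assert (Hw0 : Re w <> 0) by lra.
assert (HP := RtoC_PI_neq_0). assert (HP0 := PI_RGT_0).
set (G := fun p : Z * Z => (e (IZR (fst p) * gamma) * e (IZR (snd p) * alpha)
  * (ecoef w (fst p) (snd p) - ecoef w (fst p) (snd p - 1)))%C).
destruct (lattice_diff_bound w Hw0) as [B [HB HL]].
assert (HGe : forall M K, G (M, K) = (e (IZR M * gamma) * e (IZR K * alpha) *
  (invZ M / (2 * PI)) * (/ (IZR M * w + Ci * IZR K) - / (IZR M * w + Ci * IZR (K - 1))))%C).
{ intros M K. unfold G, ecoef; cbn [fst snd]. ring. }
destruct (has_sum_exists G (fun p => 4 * B * (decay (fst p) * decay (snd p)))) as [l Hl].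
{ intros [M K]. rewrite HGe. cbn [fst snd].
  assert (D1 := decay_pos M). assert (D2 := decay_pos K).
  assert (D3 : 0 < decay M * decay K) by now apply Rmult_lt_0_compat.
  destruct (Z.eq_dec M 0) as [->|HM].
  - rewrite invZ_0. unfold Cdiv. rewrite Cmult_0_l, Cmult_0_r, Cmult_0_l, Cmod_0.
    apply Rmult_le_pos; [|lra]. lra.
  - rewrite !Cmod_mult, !Cmod_e, Cmod_div, Cmod_mult, !Cmod_R, !Rmult_1_l.
    2:{ rewrite <- RtoC_mult. apply RtoC_neq_0. lra. }
    specialize (HL M K HM). assert (Hd := decay_prod_bound M K HM).
    unfold invZ. rewrite Cmod_R, Rabs_inv, (Rabs_pos_eq 2), (Rabs_pos_eq PI) by lra.
    assert (HX := Rabs_IZR_ge_1 M HM).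
    assert (HiX : 0 < / Rabs (IZR M)) by (apply Rinv_0_lt_compat; lra).
    assert (HPi : / (2 * PI) <= 1).
    { rewrite <- Rinv_1. apply Rinv_le_contravar; [lra|]. assert (P1 := PI2_1). lra. }
    assert (HPi0 : 0 < / (2 * PI)) by (apply Rinv_0_lt_compat; lra).
    set (X := / Rabs (IZR M)) in *. unfold Rdiv.
    apply Rle_trans with (X * 1 * (B / (Rabs (IZR M) + Rabs (IZR K)) ^ 2)).
    + apply Rmult_le_compat; [apply Rmult_le_pos; lra|apply Cmod_ge_0| |exact HL].
      apply Rmult_le_compat_l; lra.
    + replace (X * 1 * (B / (Rabs (IZR M) + Rabs (IZR K)) ^ 2))
        with (B * (X * / (Rabs (IZR M) + Rabs (IZR K)) ^ 2)) by (unfold Rdiv; ring).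
      replace (4 * B * (decay M * decay K)) with (B * (4 * (decay M * decay K))) by ring.
      apply Rmult_le_compat_l; lra. }
{ apply bounded_sums_scal; [lra|].
  apply bounded_sums_prod; try (intros; left; apply decay_pos); apply bounded_sums_decay. }
assert (El : l = ((1 - e alpha) * F)%C).
{ apply has_sum_unique with (fun M => (1 - e alpha) * lambda_coef alpha gamma w M)%C;
    [|now apply has_sum_scal].
  apply has_sum_fubini with (1 := Hl). intros M.
  destruct (Z.eq_dec M 0) as [->|HM].
  - unfold lambda_coef. rewrite invZ_0, Cmult_0_l, Cmult_0_l, Cmult_0_r.
    apply has_sum_ext with (fun _ => RtoC 0); [|apply has_sum_zero].
    intros K. rewrite HGe, invZ_0. unfold Cdiv. ring.
  - assert (HMr : Re (IZR M * w) <> 0).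
    { rewrite Re_scal. apply Rmult_integral_contrapositive. split; [|exact Hw0].
      now apply eq_IZR_contrapositive. }
    replace ((1 - e alpha) * lambda_coef alpha gamma w M)%C with
      (e (IZR M * gamma) * (invZ M / (2 * PI)) *
       ((1 - e alpha) * (2 * PI * geom_ratio alpha (IZR M * w))))%C
      by (unfold lambda_coef; field; exact HP).
    eapply has_sum_ext; [|exact (has_sum_scal _ _ _ (has_sum_geom_ratio alpha _ Ha HMr))].
    intros K. rewrite HGe. ring. }
subst l.
replace ((1 - e gamma) * (1 - e alpha) * F)%C
  with ((1 - e alpha) * F - e gamma * ((1 - e alpha) * F))%C by ring.
apply has_sum_ext with (fun p => G p - e gamma * G ((fst p - 1)%Z, snd p))%C.
- intros [M K]. unfold G, mixed_diff; cbn [fst snd].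
  replace (IZR M * gamma) with (gamma + IZR (M - 1) * gamma) by (rewrite minus_IZR; ring).
  rewrite e_plus. ring.
- apply has_sum_minus; [exact Hl|]. apply has_sum_scal.
  apply has_sum_bijection with (p := fun p : Z * Z => ((fst p + 1)%Z, snd p))
    (q := fun p : Z * Z => ((fst p - 1)%Z, snd p)) (a := G); [| | |exact Hl].
  + intros [M K]; cbn [fst snd]. f_equal. lia.
  + intros [M K]; cbn [fst snd]. f_equal. lia.
  + intros [M K]; cbn [fst snd]. f_equal. f_equal. lia.
Qed.

(* The coefficients of [Lambda (1 - gamma) alpha (/ w)] in the variables of
   [Lambda alpha gamma w]: the frequencies are exchanged, one with a sign. *)
Lemma has_sum_ecoef_swap alpha gamma w F : 0 < Re w -> 0 < gamma < 1 ->
  has_sum (lambda_coef (1 - gamma) alpha w) F ->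
  has_sum (fun p : Z * Z => e (IZR (fst p) * gamma) * e (IZR (snd p) * alpha)
      * mixed_diff (fun M K => ecoef w K (- M)) (fst p) (snd p))%C
    ((1 - e gamma) * (1 - e alpha) * F)%C.
Proof.
intros Hw Hg HF.
assert (H := has_sum_scal (- e gamma) _ _
  (has_sum_ecoef (1 - gamma) alpha w F Hw ltac:(lra) HF)).
assert (E1 : (e gamma * e (1 - gamma))%C = 1).
{ rewrite <- e_plus. replace (gamma + (1 - gamma)) with 1 by ring. exact (e_Z 1). }
replace ((1 - e gamma) * (1 - e alpha) * F)%C
  with (- e gamma * ((1 - e alpha) * (1 - e (1 - gamma)) * F))%C.
2:{ replace (- e gamma * ((1 - e alpha) * (1 - e (1 - gamma)) * F))%C with
     ((1 - e alpha) * (e gamma * e (1 - gamma) - e gamma) * F)%C by ring.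
    rewrite E1. ring. }
(* Negating a frequency turns a backward difference into a forward one. The shift by [1] restores
   it, at the price of a sign and a factor [e gamma], which the scaling by [- e gamma] supplies. *)
apply has_sum_bijection with (p := fun p : Z * Z => ((1 - snd p)%Z, fst p))
  (q := fun p : Z * Z => (snd p, (1 - fst p)%Z)) (4 := H).
- intros [M K]; cbn [fst snd]. f_equal. lia.
- intros [M K]; cbn [fst snd]. f_equal. lia.
- intros [M K]; cbn [fst snd].
  assert (E2 : e (IZR (1 - K) * gamma) = (e gamma * e (IZR K * (1 - gamma)))%C).
  { replace (IZR (1 - K) * gamma) with (gamma + IZR K * (1 - gamma) + IZR (- K))
      by (rewrite minus_IZR, opp_IZR; ring).
    rewrite !e_plus, e_Z. ring. }
  rewrite E2. unfold mixed_diff.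
  replace (- (1 - K))%Z with (K - 1)%Z by lia.
  replace (- (1 - K - 1))%Z with K by lia. ring.
Qed.

(** * The polynomial part as a double Fourier series *)

(** The Fourier coefficients of the constant [1], needed because each [B_2] term depends on one of
    the two variables only. *)
Definition delta0 (k : Z) : C := if Z.eq_dec k 0 then RtoC 1 else RtoC 0.

Lemma has_sum_delta0 x :
  has_sum (fun k => (delta0 k - delta0 (k - 1)) * e (IZR k * x))%C (1 - e x)%C.
Proof.
apply has_sum_ext with (fun k => delta0 k * e (IZR k * x)
  - delta0 (k - 1) * e (IZR k * x))%C; [intros k; ring|].
apply has_sum_minus.
- replace (RtoC 1) with (delta0 0 * e (IZR 0 * x))%C.
  + apply (has_sum_single (fun k => delta0 k * e (IZR k * x))%C).
    intros k Hk. unfold delta0. destruct (Z.eq_dec k 0); [congruence|ring].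
  + rewrite Rmult_0_l, e_0. unfold delta0. simpl. ring.
- replace (e x) with (delta0 (1 - 1) * e (IZR 1 * x))%C.
  + apply (has_sum_single (fun k => delta0 (k - 1) * e (IZR k * x))%C).
    intros k Hk. unfold delta0. destruct (Z.eq_dec (k - 1) 0); [lia|ring].
  + rewrite Rmult_1_l. unfold delta0. simpl. ring.
Qed.

Lemma delta0_diff_bound k : Cmod (delta0 k - delta0 (k - 1)) <= 4 * decay k.
Proof.
eapply Rle_trans; [|apply Rmult_le_compat_l; [lra|apply inv_sqr_le_decay]].
unfold delta0. destruct (Z.eq_dec k 0) as [->|H0].
{ destruct (Z.eq_dec (0 - 1) 0); [lia|].
  replace (1 - 0)%C with (RtoC 1) by ring. rewrite Cmod_1, Rabs_R0. lra. }
destruct (Z.eq_dec (k - 1) 0) as [H1|H1].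
{ replace k with 1%Z by lia. replace (0 - 1)%C with (- (1))%C by ring.
  rewrite Cmod_m1, Rabs_R1. lra. }
replace (0 - 0)%C with (RtoC 0) by ring. rewrite Cmod_0.
assert (H := Rabs_pos (IZR k)).
assert (0 < / (1 + Rabs (IZR k)) ^ 2) by (apply Rinv_0_lt_compat, pow_lt; lra). lra.
Qed.

Lemma has_sum_invZ_sqr_diff x : 0 < x < 1 ->
  has_sum (fun k => (invZ k ^ 2 - invZ (k - 1) ^ 2) * e (IZR k * x))%C
    ((1 - e x) * (2 * PI ^ 2 * (x ^ 2 - x + 1 / 6)))%C.
Proof.
intros Hx. assert (H := has_sum_B2 x Hx).
set (s := (2 * PI ^ 2 * (x ^ 2 - x + 1 / 6))%C) in *.
replace ((1 - e x) * s)%C with (s - e x * s)%C by ring.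
apply has_sum_ext with (fun k => invZ k ^ 2 * e (IZR k * x)
  - e x * (invZ (k - 1) ^ 2 * e (IZR (k - 1) * x)))%C.
- intros k. replace (IZR k * x) with (x + IZR (k - 1) * x) by (rewrite minus_IZR; ring).
  rewrite e_plus. ring.
- apply has_sum_minus; [exact H|]. apply has_sum_scal.
  apply has_sum_bijection with (p := fun k => (k + 1)%Z) (q := fun k => (k - 1)%Z) (4 := H);
    intros k; [lia|lia|]. now replace (k + 1 - 1)%Z with k by lia.
Qed.

Lemma Cmod_invZ_le_1 k : Cmod (invZ k) <= 1.
Proof.
destruct (Z.eq_dec k 0) as [->|H].
- rewrite invZ_0, Cmod_0. lra.
- unfold invZ. rewrite Cmod_R, Rabs_inv, <- Rinv_1.
  apply Rinv_le_contravar; [lra|now apply Rabs_IZR_ge_1].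
Qed.

Lemma invZ_sqr_diff_bound k : Cmod (invZ k ^ 2 - invZ (k - 1) ^ 2) <= 12 * decay k.
Proof.
replace (invZ k ^ 2 - invZ (k - 1) ^ 2)%C
  with ((invZ k + invZ (k - 1)) * (invZ k - invZ (k - 1)))%C by ring.
rewrite Cmod_mult. replace (12 * decay k) with (2 * (6 * decay k)) by ring.
apply Rmult_le_compat; try apply Cmod_ge_0; [|apply invZ_diff_bound].
eapply Rle_trans; [apply Cmod_triangle|].
assert (H1 := Cmod_invZ_le_1 k). assert (H2 := Cmod_invZ_le_1 (k - 1)). lra.
Qed.

(** In order, the coefficients of [2 PI i B_1(alpha) B_1(gamma)], of [(PI / w) B_2(gamma)] and of
    [- PI w B_2(alpha)], with [M] dual to [gamma] and [K] to [alpha]. *)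
Definition g0coef (w : C) (M K : Z) : C :=
  (- Ci / (2 * PI) * (invZ M * invZ K) + / (2 * PI * w) * (invZ M ^ 2 * delta0 K)
   - w / (2 * PI) * (delta0 M * invZ K ^ 2))%C.

Lemma Re_neq_0 w : Re w <> 0 -> w <> 0.
Proof. intros H E. apply H. now rewrite E. Qed.

(* Partial fractions: the two Eisenstein-type coefficients differ by a sum of
   products of functions of one variable. *)
Lemma ecoef_minus_swap w M K : Re w <> 0 ->
  (ecoef w M K - ecoef (/ w) K (- M))%C = g0coef w M K.
Proof.
intros Hw. assert (Hw' := Re_neq_0 w Hw).
assert (HP := RtoC_PI_neq_0). assert (HC := Ci_neq_0).
unfold ecoef, g0coef, delta0.
(* On an axis [invZ 0 = 0] annihilates at least one of the two coefficients, and what is left is a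
   [B_2] term. Off the axes the swapped denominator is [- i / w] times [M w + i K], so the two
   fractions combine. *)
destruct (Z.eq_dec M 0) as [->|HM], (Z.eq_dec K 0) as [->|HK].
- rewrite invZ_0. unfold Cdiv. ring.
- assert (HK' : RtoC (IZR K) <> 0) by now apply RtoC_neq_0, eq_IZR_contrapositive.
  rewrite invZ_0, (invZ_neq K HK). change (- 0)%Z with 0%Z.
  replace (IZR K * / w + Ci * 0)%C with (IZR K / w)%C by (field; exact Hw').
  replace (0 / (2 * PI))%C with (RtoC 0) by (field; exact HP).
  rewrite Cmult_0_l. field. repeat split; trivial.
- assert (HM' : RtoC (IZR M) <> 0) by now apply RtoC_neq_0, eq_IZR_contrapositive.
  rewrite invZ_0, (invZ_neq M HM).
  replace (IZR M * w + Ci * 0)%C with (IZR M * w)%C by ring.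
  replace (0 / (2 * PI))%C with (RtoC 0) by (field; exact HP).
  rewrite Cmult_0_l. field. repeat split; trivial.
- assert (HM1 : IZR M <> 0) by now apply eq_IZR_contrapositive.
  assert (HM' : RtoC (IZR M) <> 0) by now apply RtoC_neq_0.
  assert (HK' : RtoC (IZR K) <> 0) by now apply RtoC_neq_0, eq_IZR_contrapositive.
  rewrite (invZ_neq M HM), (invZ_neq K HK), opp_IZR, RtoC_opp.
  assert (HA := lattice_neq_0 w (IZR M) (IZR K) Hw HM1).
  replace (IZR K * / w + Ci * - IZR M)%C with (- Ci * (IZR M * w + Ci * IZR K) / w)%C.
  2:{ replace (- Ci * (IZR M * w + Ci * IZR K))%C
        with (- Ci * IZR M * w - Ci * Ci * IZR K)%C by ring.
      rewrite Ci_sqr. field. exact Hw'. }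
  replace (/ (- Ci * (IZR M * w + Ci * IZR K) / w))%C
    with (Ci * w / (IZR M * w + Ci * IZR K))%C.
  2:{ replace (Ci * w)%C with (- (w / Ci) * - (Ci * Ci))%C by (field; exact HC).
      rewrite Ci_sqr. field. repeat split; trivial. }
  set (A := (IZR M * w + Ci * IZR K)%C) in *.
  replace (/ IZR M / (2 * PI) * / A - / IZR K / (2 * PI) * (Ci * w / A))%C
    with ((IZR K - Ci * w * IZR M) / (2 * PI * IZR M * IZR K * A))%C
    by (field; repeat split; trivial).
  replace (IZR K - Ci * w * IZR M)%C with (- Ci * A)%C.
  + field. repeat split; trivial.
  + unfold A. replace (- Ci * (IZR M * w + Ci * IZR K))%C
      with (- Ci * IZR M * w - Ci * Ci * IZR K)%C by ring.
    rewrite Ci_sqr. ring.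
Qed.

(** Each summand of [g0coef] is a function of [M] times a function of [K], and the mixed difference
    of such a product is the product of the differences. Three products of absolutely convergent
    series in one variable remain. *)
Lemma has_sum_g0coef alpha gamma w : Re w <> 0 -> 0 < alpha < 1 -> 0 < gamma < 1 ->
  has_sum (fun p : Z * Z => e (IZR (fst p) * gamma) * e (IZR (snd p) * alpha)
      * mixed_diff (g0coef w) (fst p) (snd p))%C
    ((1 - e gamma) * (1 - e alpha) *
      (PI / w * (gamma ^ 2 - gamma + 1 / 6) - PI * w * (alpha ^ 2 - alpha + 1 / 6)
       + 2 * PI * Ci * (alpha - 1 / 2) * (gamma - 1 / 2)))%C.
Proof.
intros Hw Ha Hg. assert (Hw' := Re_neq_0 w Hw).
assert (HP := RtoC_PI_neq_0).
assert (Hbd : forall (u : Z -> C) (A x : R), (forall k, Cmod (u k) <= A * decay k) ->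
  forall k, Cmod (u k * e (IZR k * x)) <= A * decay k).
{ intros u A x Hu k. rewrite Cmod_mult, Cmod_e, Rmult_1_r. apply Hu. }
assert (Hbs : forall A, 0 <= A -> bounded_sums (fun k => A * decay k)).
{ intros A HA. apply bounded_sums_scal; [exact HA|apply bounded_sums_decay]. }
assert (S1 := has_sum_mult _ _ _ _ _ _ (Hbd _ _ gamma invZ_diff_bound) (Hbs 6 ltac:(lra))
  (Hbd _ _ alpha invZ_diff_bound) (Hbs 6 ltac:(lra)) (has_sum_B1 gamma Hg) (has_sum_B1 alpha Ha)).
assert (S2 := has_sum_mult _ _ _ _ _ _ (Hbd _ _ gamma invZ_sqr_diff_bound) (Hbs 12 ltac:(lra))
  (Hbd _ _ alpha delta0_diff_bound) (Hbs 4 ltac:(lra))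
  (has_sum_invZ_sqr_diff gamma Hg) (has_sum_delta0 alpha)).
assert (S3 := has_sum_mult _ _ _ _ _ _ (Hbd _ _ gamma delta0_diff_bound) (Hbs 4 ltac:(lra))
  (Hbd _ _ alpha invZ_sqr_diff_bound) (Hbs 12 ltac:(lra))
  (has_sum_delta0 gamma) (has_sum_invZ_sqr_diff alpha Ha)).
apply (has_sum_scal (- Ci / (2 * PI))) in S1.
apply (has_sum_scal (/ (2 * PI * w))) in S2.
apply (has_sum_scal (w / (2 * PI))) in S3.
assert (S := has_sum_minus _ _ _ _ (has_sum_plus _ _ _ _ S1 S2) S3).
match type of S with has_sum _ ?v => set (V := v) in S end.
match goal with |- has_sum _ ?v => replace v with V end.
- apply has_sum_ext with (2 := S). intros [M K]. cbn [fst snd].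
  unfold mixed_diff, g0coef. field. now split.
- unfold V.
  replace (- Ci / (2 * PI) * (- (1 - e gamma) * (2 * PI * Ci * (gamma - 1 / 2)) *
     (- (1 - e alpha) * (2 * PI * Ci * (alpha - 1 / 2)))))%C with
    (- (Ci * Ci) * (2 * PI * Ci * (1 - e gamma) * (1 - e alpha)
      * (alpha - 1 / 2) * (gamma - 1 / 2)))%C by (field; exact HP).
  rewrite Ci_sqr. field. now split.
Qed.

(** * Comparison of the two sides and return to [Lambda] *)

(** By linearity of [mixed_diff], the identity [ecoef_minus_swap] compares the double series term by
    term. Uniqueness of sums gives the claim multiplied by [(1 - e gamma) (1 - e alpha)], which is
    nonzero. *)
Lemma lambda_reciprocity alpha gamma w F F' :
  0 < Re w -> 0 < alpha < 1 -> 0 < gamma < 1 ->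
  has_sum (lambda_coef alpha gamma w) F ->
  has_sum (lambda_coef (1 - gamma) alpha (/ w)) F' ->
  F = (F' + (PI / w * (gamma ^ 2 - gamma + 1 / 6) - PI * w * (alpha ^ 2 - alpha + 1 / 6)
       + 2 * PI * Ci * (alpha - 1 / 2) * (gamma - 1 / 2)))%C.
Proof.
intros Hw Ha Hg HF HF'.
assert (Hw0 : Re w <> 0) by lra.
assert (Hiw : 0 < Re (/ w)).
{ destruct w as [a b]. simpl in *. apply Rdiv_lt_0_compat; nra. }
assert (H1 := has_sum_ecoef alpha gamma w F Hw Ha HF).
assert (H2 := has_sum_ecoef_swap alpha gamma (/ w)%C F' Hiw Hg HF').
assert (H3 := has_sum_g0coef alpha gamma w Hw0 Ha Hg).
set (g := (PI / w * (gamma ^ 2 - gamma + 1 / 6) - PI * w * (alpha ^ 2 - alpha + 1 / 6)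
       + 2 * PI * Ci * (alpha - 1 / 2) * (gamma - 1 / 2))%C) in *.
assert (N1 := e_neq_1 alpha Ha). assert (N2 := e_neq_1 gamma Hg).
assert (E : ((1 - e gamma) * (1 - e alpha) * F - (1 - e gamma) * (1 - e alpha) * F')%C
  = ((1 - e gamma) * (1 - e alpha) * g)%C).
{ eapply has_sum_unique; [exact (has_sum_minus _ _ _ _ H1 H2)|].
  apply has_sum_ext with (2 := H3). intros [M K]. cbn [fst snd].
  unfold mixed_diff. rewrite <- !(ecoef_minus_swap w) by exact Hw0. ring. }
replace F with (((1 - e gamma) * (1 - e alpha) * F - (1 - e gamma) * (1 - e alpha) * F')
  / ((1 - e gamma) * (1 - e alpha)) + F')%C by (field; now split).
rewrite E. field. now split.
Qed.

(** A complex [theta] can change the decay of the arguments as well as their phase. Hence the real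
    pair [alpha0], [gamma], which records the effective exponent and phase and serves both
    occurrences of [Lambda]. *)
Lemma Lambda_value (alpha beta : R) (w theta : C) (alpha0 gamma : R) F :
  0 < Re w -> 0 < alpha0 < 1 ->
  (forall n, Lambda_arg1 alpha beta w theta n =
    (e gamma * Cexp (alpha0 * (- (2 * PI) * w)) * Cexp (- (2 * PI) * w) ^ n)%C) ->
  (forall n, Lambda_arg2 alpha beta w theta n =
    (e (- gamma) * Cexp ((1 - alpha0)%R * (- (2 * PI) * w)) * Cexp (- (2 * PI) * w) ^ n)%C) ->
  has_sum (lambda_coef alpha0 gamma w) F ->
  Lambda_defined alpha beta w theta /\ Lambda alpha beta w theta = F.
Proof.
intros Hw Ha H1 H2 HF.
destruct (lambda_as_Z_sum alpha0 gamma w Hw Ha) as [F0 [HF0 HS]].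
rewrite (has_sum_unique _ _ _ HF HF0). clear F HF.
assert (HT : is_series (V := C_NormedModule) (Lambda_term alpha beta w theta) (- F0)%C).
{ apply has_sum_is_series. apply has_sum_ext with (2 := HS).
  intros n. unfold Lambda_term. now rewrite H1, H2. }
assert (Hlt : forall x y n, 0 < x ->
  Cmod (e y * Cexp (x * (- (2 * PI) * w)) * Cexp (- (2 * PI) * w) ^ n) < 1).
{ intros x y n Hx.
  rewrite <- Cexp_INR_mult, <- Cmult_assoc, <- Cexp_plus, Cmod_mult, Cmod_e, Rmult_1_l.
  replace (x * (- (2 * PI) * w) + INR n * (- (2 * PI) * w))%C
    with ((x + INR n)%R * (- (2 * PI) * w))%C by (rewrite RtoC_plus; ring).
  apply Cmod_Cexp_lt_1; [|exact Hw]. assert (H := pos_INR n). lra. }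
split.
- split; [exact Hw|]. split.
  + intros n. rewrite H1, H2. split; apply Hlt; lra.
  + eexists. exact HT.
- unfold Lambda. rewrite (CSeries_unique _ _ HT). ring.
Qed.

Theorem theorem1 (w : C) (alpha beta theta : R)
  (hw : 0 < Re w)
  (halpha : 0 < alpha < 1)
  (hbetatheta : 0 < beta + theta < 1) :
  Lambda_defined alpha beta w theta /\
  Lambda_defined (1 - beta) alpha (/ w)%C (- (Ci * theta / w))%C /\
  Lambda alpha beta w theta =
    (Lambda (1 - beta) alpha (/ w) (- (Ci * theta / w)) + g0 alpha beta w theta)%C.
Proof.
set (gamma := beta + theta) in *.
assert (Hw0 : Re w <> 0) by lra. assert (Hw' := Re_neq_0 w Hw0).
assert (Hiw : 0 < Re (/ w)).
{ destruct w as [a b]. simpl in *. apply Rdiv_lt_0_compat; nra. }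
assert (Hg : 0 < 1 - gamma < 1) by lra.
destruct (lambda_as_Z_sum alpha gamma w hw halpha) as [F [HF _]].
destruct (lambda_as_Z_sum (1 - gamma) alpha (/ w)%C Hiw Hg) as [F' [HF' _]].
assert (Ei : forall u : C, (Ci * (Ci * u))%C = (- u)%C).
{ intros u. rewrite Cmult_assoc, Ci_sqr. ring. }
destruct (Lambda_value alpha beta w theta alpha gamma F hw halpha) as [D V]; [| |exact HF|].
{ intros n. unfold Lambda_arg1, gamma. rewrite e_Cexp, <- Cexp_INR_mult, <- !Cexp_plus.
  f_equal. rewrite RtoC_plus. ring. }
{ intros n. unfold Lambda_arg2, gamma. rewrite e_Cexp, <- Cexp_INR_mult, <- !Cexp_plus.
  f_equal. rewrite RtoC_opp, RtoC_minus, RtoC_plus. ring. }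
(* Here [2 pi i] times the fourth argument is [2 pi theta / w], a real multiple of [/ w]: it moves
   the exponent from [1 - beta] to [1 - beta - theta = 1 - gamma] and leaves the phase [alpha]
   unchanged. *)
destruct (Lambda_value (1 - beta) alpha (/ w)%C (- (Ci * theta / w))%C (1 - gamma) alpha F'
  Hiw Hg) as [D' V']; [| |exact HF'|].
{ intros n. unfold Lambda_arg1, gamma. rewrite e_Cexp, <- Cexp_INR_mult, <- !Cexp_plus.
  f_equal. replace (2 * PI * Ci * - (Ci * theta / w))%C
    with (- (2 * PI * (Ci * (Ci * (theta / w)))))%C by (unfold Cdiv; ring).
  rewrite Ei, !RtoC_minus, RtoC_plus. unfold Cdiv. ring. }
{ intros n. unfold Lambda_arg2, gamma. rewrite e_Cexp, <- Cexp_INR_mult, <- !Cexp_plus.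
  f_equal. replace (2 * PI * Ci * - (Ci * theta / w))%C
    with (- (2 * PI * (Ci * (Ci * (theta / w)))))%C by (unfold Cdiv; ring).
  rewrite Ei, RtoC_opp, !RtoC_minus, RtoC_plus. unfold Cdiv. ring. }
split; [exact D|]. split; [exact D'|].
rewrite V, V', (lambda_reciprocity alpha gamma w F F' hw halpha hbetatheta HF HF').
f_equal. unfold g0. fold gamma.
rewrite !bernoulli_poly_1, !bernoulli_poly_2, !RtoC_plus, !RtoC_minus, <- !RtoC_pow.
rewrite !RtoC_div by lra. reflexivity.
Qed.
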